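(* Let $P\in\tilde{\mathcal S}(\mathbb F_q)$, and put $\mathfrak g_1:=q^2-q_0q+q_0$, $\mathfrak g_2:=q^2-q+2q_0$, $\mathfrak g_3:=q^2$, $\mathfrak g_4:=q^2+1$ and $$A:=\{h\mathfrak g_1+i\mathfrak g_2+j\mathfrak g_3+k\mathfrak g_4\mid 0\le h\le 1,\ 0\le i\le q_0-1,\ 0\le j\le q-2q_0,\ 0\le k\le q_0-1\}$$ (with $h,i,j,k$ integers). Then $\mathrm{Ap}(H(P))=A$. Further, $H(P)$ is a symmetric semigroup.
   Context: Let $q_0=2^s$ with $s\ge 1$ an integer and $q=2q_0^2$. $\tilde{\mathcal S}$ denotes the nonsingular projective curve (nonsingular model) over $\mathbb F_q$ of the affine curve defined by $y^q+y=x^{q_0}(x^q+x)$ and $t^{q-2q_0+1}=x^q+x$. It has a unique point at infinity $P_\infty$ (a single place), which is $\mathbb F_q$-rational; $\tilde{\mathcal S}(\mathbb F_q)$ is the set of $\mathbb F_q$-rational points, including $P_\infty$. For a point $P\in\tilde{\mathcal S}(\overline{\mathbb F}_q)$, the Weierstrass semigroup $H(P)$ is the set of $n\in\mathbb N=\{0,1,2,\dots\}$ for which there is a rational function on $\tilde{\mathcal S}$ (over $\overline{\mathbb F}_q$) with pole divisor $nP$. For a numerical semigroup $Z\subset\mathbb N$: the genus is $g(Z)=|\mathbb N\setminus Z|$, the multiplicity is $m_Z=\min\{z\in Z\mid z>0\}$, the conductor is $c_Z=1+\max\{z\in\mathbb N\setminus Z\}$, the Ap\'ery set is $\mathrm{Ap}(Z)=\{z\in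 Z\mid z-m_Z\notin Z\}$, and $Z$ is called symmetric if $c_Z=2g(Z)$. *)

(* Defs.v *)
From mathcomp Require Import all_boot all_order all_algebra.
From mathcomp Require Import finmap boolp classical_sets functions cardinality.
From mathcomp Require Import mpoly.

Set Implicit Arguments.
Unset Strict Implicit.
Unset Printing Implicit Defensive.

Import Order.TTheory GRing.Theory Num.Theory.

Local Open Scope classical_set_scope.
Local Open Scope ring_scope.

(** * Numerical semigroups *)

Definition numerical_semigroup (Z : set nat) : Prop :=
  [/\ Z 0%N,
      forall a b : nat, Z a -> Z b -> Z (a + b)%N
    & finite_set (~` Z)].

(* [fset_set] of an infinite set is empty, so [genus] and [conductor] carry
   their meaning only when the complement of [Z] is finite. *)
Definition genus (Z : set nat) : nat := #|` fset_set (~` Z)|.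

(* 1 + max of the gaps; 0 when there are no gaps. *)
Definition conductor (Z : set nat) : nat :=
  (\max_(z <- fset_set (~` Z)) z.+1)%N.

Definition multiplicity (Z : set nat) : nat :=
  xget 0%N [set m | [/\ Z m, (0 < m)%N
                      & forall z, Z z -> (0 < z)%N -> (m <= z)%N]].

(* The difference z - m_Z is taken in the integers: when z < m_Z it is negative,
   hence not in Z.  The guard compensates for truncated subtraction. *)
Definition Apery (Z : set nat) : set nat :=
  let m := multiplicity Z in
  [set z | Z z /\ ~ ((m <= z)%N /\ Z (z - m)%N)].

Definition symmetric_semigroup (Z : set nat) : Prop :=
  numerical_semigroup Z /\ conductor Z = (2 * genus Z)%N.

(** * Points of a nonsingular projective curve *)

(* Let F be a function field in one variable over an algebraically closed field
   K.  The points of the nonsingular projective curve with function field F are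
   the discrete valuation rings of F/K; each is given here by its normalized
   valuation.  The value at 0, mathematically +oo, is the junk value 0, so that a
   point is determined by its valuation; with it, [0 <= ord f] holds for f = 0. *)
Record curve_point (K F : fieldType) (emb : {rmorphism K -> F}) := CurvePoint {
  ord :> F -> int;
  ord_zero : ord 0 = 0;
  ordM : forall f g, f != 0 -> g != 0 -> ord (f * g) = ord f + ord g;
  ordD : forall f g, f != 0 -> g != 0 -> f + g != 0 ->
           Num.min (ord f) (ord g) <= ord (f + g);
  ordC : forall c : K, c != 0 -> ord (emb c) = 0;
  ord_uniformizer : exists2 f, f != 0 & ord f = 1
}.

Section Points.
Variables (K F : fieldType) (emb : {rmorphism K -> F}).
Implicit Types (P Q : curve_point emb) (f : F).

Lemma curve_point_ext P Q : ord P =1 ord Q -> P = Q.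
Proof.
case: P => v v0 vM vD vC vu; case: Q => w w0 wM wD wC wu /= /funext vw.
by case: _ / vw w0 wM wD wC wu => *; congr CurvePoint; exact: Prop_irrelevance.
Qed.

Definition regular_at P f : Prop := 0 <= ord P f.

Definition vanishes_at P f : Prop := f = 0 \/ 0 < ord P f.

Definition pole_order P f : nat := if ord P f < 0 then `|ord P f|%N else 0%N.

Definition Weierstrass_semigroup P : set nat :=
  [set n | exists2 f, f != 0 &
     forall Q, pole_order Q f = (if `[< Q = P >] then n else 0%N)].

End Points.

(** * Function field of an affine space curve *)

Definition triple (T : Type) (a b c : T) : 'I_3 -> T := tnth [tuple a; b; c].

(* F is the fraction field of the coordinate ring K[X,Y,T]/I(C), where I(C) is
   the ideal of the polynomials vanishing on C in K^3, and x, y, t are the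
   classes of the coordinates X, Y, T.  K is meant to be algebraically closed. *)
Definition is_function_field (K : fieldType) (C : K -> K -> K -> Prop)
    (F : fieldType) (emb : {rmorphism K -> F}) (x y t : F) : Prop :=
  (forall p : {mpoly K[3]},
     mmap emb (triple x y t) p = 0 <->
     (forall a b c : K, C a b c -> p.@[triple a b c] = 0)) /\
  (forall f : F, exists p r : {mpoly K[3]},
     mmap emb (triple x y t) r != 0 /\
     f = mmap emb (triple x y t) p / mmap emb (triple x y t) r).

(* A point P is rational over the subfield k of K if its residue field, as a
   place of k(x, y, t), is k: each f in k(x, y, t) which is regular at P has its
   value f(P) in k. *)
Definition rational_point (k K F : fieldType) (iota : {rmorphism k -> K})
    (emb : {rmorphism K -> F}) (x y t : F) (P : curve_point emb) : Prop :=
  forall p r : {mpoly k[3]},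
    let f := mmap (emb \o iota) (triple x y t) p /
             mmap (emb \o iota) (triple x y t) r in
    mmap (emb \o iota) (triple x y t) r != 0 ->
    regular_at P f ->
    exists c : k, vanishes_at P (f - emb (iota c)).

(** * The curve *)

Definition q0 (s : nat) : nat := (2 ^ s)%N.
Definition q (s : nat) : nat := (2 * q0 s ^ 2)%N.

Definition affine_curve (s : nat) (K : fieldType) (a b c : K) : Prop :=
  b ^+ q s + b = a ^+ q0 s * (a ^+ q s + a) /\
  c ^+ (q s - 2 * q0 s + 1) = a ^+ q s + a.

Definition gen1 (s : nat) : nat := (q s ^ 2 - q0 s * q s + q0 s)%N.
Definition gen2 (s : nat) : nat := (q s ^ 2 - q s + 2 * q0 s)%N.
Definition gen3 (s : nat) : nat := (q s ^ 2)%N.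
Definition gen4 (s : nat) : nat := (q s ^ 2 + 1)%N.

Definition Aset (s : nat) : set nat :=
  [set n | exists h i j k : nat,
     [/\ (h <= 1)%N, (i <= q0 s - 1)%N, (j <= q s - 2 * q0 s)%N,
         (k <= q0 s - 1)%N
       & n = (h * gen1 s + i * gen2 s + j * gen3 s + k * gen4 s)%N]].

(* Main.v *)
Require Import Defs.
From HB Require Import structures.
From mathcomp Require Import all_boot all_order all_algebra finfield.
From mathcomp Require Import finmap boolp classical_sets functions cardinality.
From mathcomp Require Import mpoly.
From mathcomp Require Import ring zify.

Set Implicit Arguments.
Unset Strict Implicit.
Unset Printing Implicit Defensive.

Import Order.TTheory GRing.Theory Num.Theory.

Local Open Scope ring_scope.

(** Write d = q_0, m = q - 2d + 1, z = x^(2d+1) + y^(2d), w = x y^(2d) + z^(2d).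
    The relations y^2 = w + x z, z^d = y + x^(d+1), w^d = z + x^d y and
    t^m = x^q + x write every element of R = K[x, y, t] as a K[x]-combination of
    the qm monomials y^h z^i t^j w^k with h < 2, i < d, j < m, k < d.  At a pole
    of x, the orders of x, y, z, t, w are -qm, -g_1, -g_2, -g_3, -g_4, and those
    of the monomials are pairwise distinct modulo qm.  Hence there is exactly one
    such place, P_oo, and the pole orders there of the nonzero elements of R are
    the a + qm l with a in A.  A function regular away from P_oo lies in R: at
    every affine point t - c is a uniformizer, so the local ring there is a
    discrete valuation ring, and the ideal of the r in R with r f in R is
    contained in no maximal ideal.  Thus H(P_oo) = A + qm N, whose Apery set is A,
    and the symmetry of A gives that of H(P_oo).
    If P is an affine rational point, a translation moves it to the origin, and
    (z/w, y/w, t/w) satisfy the equations of the curve again, generate the same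
    field, and the first of them has a pole at P. *)

(** * Equations of the curve *)

Section Exponents.
Variable s : nat.
Hypothesis hs : (1 <= s)%N.
Local Notation d := (q0 s).
Local Notation q := (q s).
Local Notation m := (q - 2 * d + 1)%N.

Lemma q0_ge2 : (2 <= d)%N.
Proof. by rewrite /q0 -{1}(expn1 2) leq_exp2l. Qed.

Lemma qE : q = (2 * d * d)%N.
Proof. by rewrite /Defs.q expnS expn1 mulnA. Qed.

Lemma q_expn : q = (2 ^ (2 * s + 1))%N.
Proof. by rewrite /Defs.q /q0 -expnM addn1 expnS mulnC mulnC [(s * 2)%N]mulnC. Qed.

Lemma double_q0_expn : (2 * d = 2 ^ s.+1)%N.
Proof. by rewrite /q0 expnS. Qed.

Lemma double_q0_lt_q : (2 * d < q)%N.
Proof. have := q0_ge2; rewrite qE; nia. Qed.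

(** * Arithmetic in characteristic 2 *)

Section Char2.
Variable A : comNzRingType.
Hypothesis two0 : 2%:R = 0 :> A.

(** An identity of characteristic 2 becomes a polynomial identity over the integers once half the
    difference of its sides is supplied explicitly; this is what each witness [c] below is. *)
Lemma eq_mod2 (c a b : A) : a = b + 2%:R * c -> a = b.
Proof. by rewrite two0 mul0r addr0. Qed.

Lemma oppr_mod2 (a : A) : - a = a.
Proof. apply: (eq_mod2 (c := - a)); ring. Qed.

Lemma exprD_mod2 (a b : A) k : (a + b) ^+ (2 ^ k) = a ^+ (2 ^ k) + b ^+ (2 ^ k).
Proof.
elim: k => [|k IH]; first by rewrite !expr1.
rewrite expnSr !exprM IH.
apply: (eq_mod2 (c := a ^+ (2 ^ k) * b ^+ (2 ^ k))); ring.
Qed.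

Lemma exprD_q0 (a b : A) : (a + b) ^+ d = a ^+ d + b ^+ d.
Proof. exact: exprD_mod2. Qed.

Lemma exprD_2q0 (a b : A) : (a + b) ^+ (2 * d) = a ^+ (2 * d) + b ^+ (2 * d).
Proof. by rewrite double_q0_expn exprD_mod2. Qed.

Lemma exprD_q (a b : A) : (a + b) ^+ q = a ^+ q + b ^+ q.
Proof. by rewrite q_expn exprD_mod2. Qed.

End Char2.

(* Stated over commutative rings so as to apply to F * K, in which evaluation of
   functions at an affine point is encoded. *)
Definition skabelund_eqs (A : comNzRingType) (x y t : A) :=
  y ^+ q + y = x ^+ d * (x ^+ q + x) /\ t ^+ m = x ^+ q + x.

Definition zfun (A : comNzRingType) (x y : A) : A := x ^+ (2 * d + 1) + y ^+ (2 * d).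
Definition wfun (A : comNzRingType) (x y : A) : A :=
  x * y ^+ (2 * d) + zfun x y ^+ (2 * d).

(** * Frobenius relations between x, y, z and w *)

Section Relations.
Variable A : comNzRingType.
Hypothesis two0 : 2%:R = 0 :> A.
Variables (x y t : A).
Hypothesis exyt : skabelund_eqs x y t.
Local Notation z := (zfun x y).
Local Notation w := (wfun x y).

Lemma y_expq : y ^+ q = y + x ^+ d * (x ^+ q + x).
Proof. rewrite -(proj1 exyt); apply: (eq_mod2 two0 (c := - y)); ring. Qed.

Lemma y_exp2q0 : y ^+ (2 * d) = z + x * (x ^+ d) ^+ 2.
Proof.
rewrite /zfun exprD expr1 mulnC exprM.
apply: (eq_mod2 two0 (c := - ((x ^+ d) ^+ 2 * x))); rewrite !exprM; ring.
Qed.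

(** Since 2d^2 = q, the d-th power turns y^(2d) into y^q, which the curve equation reduces; the two
    terms x^(q+d) then cancel. *)
Lemma z_expq0 : z ^+ d = y + x ^+ d.+1.
Proof.
rewrite exprD_q0 // -!exprM -qE y_expq mulnDl -qE mul1n exprS exprD.
apply: (eq_mod2 two0 (c := x ^+ q * x ^+ d)); ring.
Qed.

Lemma z_exp2q0 : z ^+ (2 * d) = y ^+ 2 + (x ^+ d) ^+ 2 * x ^+ 2.
Proof.
rewrite mulnC exprM z_expq0 (exprS x d).
apply: (eq_mod2 two0 (c := y * (x * x ^+ d))); ring.
Qed.

Lemma y_sqr : y ^+ 2 = w + x * z.
Proof.
rewrite /wfun z_exp2q0 y_exp2q0.
apply: (eq_mod2 two0 (c := - (x * z) - (x ^+ d) ^+ 2 * x ^+ 2)); ring.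
Qed.

Lemma z_expq : z ^+ q = z + (x ^+ d) ^+ 2 * (x ^+ q + x).
Proof.
have -> : z ^+ q = (z ^+ d) ^+ (2 * d) by rewrite -exprM; congr (_ ^+ _); rewrite qE; nia.
have e : (x ^+ d.+1) ^+ (2 * d) = x ^+ q * (x ^+ d) ^+ 2.
  by rewrite -!exprM -exprD; congr (_ ^+ _); rewrite qE; nia.
rewrite z_expq0 exprD_2q0 // y_exp2q0 e; ring.
Qed.

Lemma w_expq0 : w ^+ d = z + x ^+ d * y.
Proof.
have e (v : A) : (v ^+ (2 * d)) ^+ d = v ^+ q by rewrite -exprM -qE.
rewrite /wfun exprD_q0 // exprMn !e z_expq y_expq.
apply: (eq_mod2 two0 (c := (x ^+ d) ^+ 2 * (x ^+ q + x))); ring.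
Qed.

Lemma w_expq : w ^+ q = w + y ^+ (2 * d) * (x ^+ q + x).
Proof.
have -> : w ^+ q = (w ^+ d) ^+ (2 * d) by rewrite -exprM; congr (_ ^+ _); rewrite qE; nia.
have e : (x ^+ d) ^+ (2 * d) = x ^+ q by rewrite -exprM; congr (_ ^+ _); rewrite qE; nia.
rewrite w_expq0 exprD_2q0 // exprMn e.
apply: (eq_mod2 two0 (c := - (x * y ^+ (2 * d)))); rewrite /wfun; ring.
Qed.

(** Together with [w_eq], this puts z and w under Artin-Schreier equations f^q + f = h like that of
    y, from which orders at zeros and poles can be read off. *)
Lemma z_eq : z ^+ q + z = (x ^+ d) ^+ 2 * (x ^+ q + x).
Proof. rewrite z_expq; apply: (eq_mod2 two0 (c := z)); ring. Qed.

Lemma w_eq : w ^+ q + w = y ^+ (2 * d) * (x ^+ q + x).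
Proof. rewrite w_expq; apply: (eq_mod2 two0 (c := w)); ring. Qed.

End Relations.

(** The term a^d (x + a) compensates the change of x^d into (x + a)^d, while x^q + x is unchanged
    because a^q = a. In characteristic 2 the new x and y vanish at (a, b). *)
Lemma skabelund_translate (A : comNzRingType) (two0 : 2%:R = 0 :> A) (x y t a b : A) :
  a ^+ q = a -> b ^+ q = b -> skabelund_eqs x y t ->
  skabelund_eqs (x + a) (y + b + a ^+ d * (x + a)) t.
Proof.
move=> aq bq [e1 e2].
have adq : (a ^+ d) ^+ q = a ^+ d by rewrite exprAC aq.
split; last first.
  rewrite e2 exprD_q // aq; apply: (eq_mod2 two0 (c := - a)); ring.
rewrite !exprD_q // exprMn exprD_q // exprD_q0 // aq bq adq.
have -> : y ^+ q = y + x ^+ d * (x ^+ q + x).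
  rewrite -e1; apply: (eq_mod2 two0 (c := - y)); ring.
apply: (eq_mod2 two0 (c := y + b - x ^+ d * a)); ring.
Qed.

(** * The inversion (x, y, t) -> (z/w, y/w, t/w) *)

Section Inversion.
Variable A : fieldType.
Hypothesis two0 : 2%:R = 0 :> A.
Variables (x y t : A).
Hypothesis exyt : skabelund_eqs x y t.
Local Notation z := (zfun x y).
Local Notation w := (wfun x y).
Hypothesis w_neq0 : w != 0.

Lemma w_exp2q0 : w ^+ (2 * d) = (z + x ^+ d * y) ^+ 2.
Proof. by rewrite mulnC exprM (w_expq0 two0 exyt). Qed.

Lemma w_sub : w = y ^+ 2 + x * z.
Proof.
rewrite (y_sqr two0 exyt); apply: (eq_mod2 two0 (c := - (x * z))); ring.
Qed.

Lemma skabelund_invert : skabelund_eqs (z / w) (y / w) (t / w).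
Proof.
have wq0 : w ^+ q != 0 by rewrite expf_neq0.
have wd0 : w ^+ d != 0 by rewrite expf_neq0.
have [_ et] := exyt.
split.
  rewrite !expr_div_n; apply: (mulIf wq0); apply: (mulIf wd0); apply: (mulIf w_neq0).
  transitivity ((y ^+ q * w + y * w ^+ q) * w ^+ d).
    by field; rewrite ?w_neq0 ?expf_neq0.
  transitivity (z ^+ d * (z ^+ q * w + z * w ^+ q)); last first.
    by field; rewrite ?w_neq0 ?expf_neq0.
  (* The Frobenius relations leave a polynomial identity in x, y, z, x^d and x^q + x. *)
  rewrite (w_expq two0 exyt) (w_expq0 two0 exyt) (z_expq two0 exyt).
  rewrite (z_expq0 two0 exyt) (y_expq two0 exyt) (y_exp2q0 two0 x y) w_sub (exprS x d).
  set X := x ^+ d; set D := x ^+ q + x.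
  apply: (eq_mod2 two0 (c := y ^+ 2 * z * X * D + y ^+ 4 * X - x ^+ 2 * z * X ^+ 3 * D - x ^+ 2 * z ^+ 2 * X)); ring.
(* Here w^(-m) = w^(2d) / w^(q+1), because m + 2d = q + 1. *)
have -> : (t / w) ^+ m = (x ^+ q + x) * w ^+ (2 * d) / (w ^+ q * w).
  rewrite expr_div_n et; apply/eqP; rewrite eqr_div ?mulf_neq0 ?expf_neq0 //.
  rewrite -mulrA -exprSr -!exprD; apply/eqP; congr (_ * _ ^+ _).
  have := double_q0_lt_q; lia.
rewrite expr_div_n -[RHS]/(z ^+ q / w ^+ q + z / w) w_exp2q0.
apply: (mulIf wq0); apply: (mulIf w_neq0).
transitivity ((x ^+ q + x) * (z + x ^+ d * y) ^+ 2).
  by field; rewrite ?w_neq0 ?expf_neq0.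
transitivity (z ^+ q * w + z * w ^+ q); last first.
  by field; rewrite ?w_neq0 ?expf_neq0.
rewrite (w_expq two0 exyt) (z_expq two0 exyt) (y_exp2q0 two0 x y) w_sub.
set X := x ^+ d; set D := x ^+ q + x.
apply: (eq_mod2 two0 (c := y * z * X * D - y ^+ 2 * z - x * z * X ^+ 2 * D - x * z ^+ 2)); ring.
Qed.

(** With [wfun_invert], this shows that the inversion is an involution: the new z and w are x/w and
    1/w, so the same formulas recover the old coordinates. *)
Lemma zfun_invert : zfun (z / w) (y / w) = x / w.
Proof.
have w2d0 : w ^+ (2 * d) != 0 by rewrite expf_neq0.
rewrite {1}/zfun !expr_div_n ![_ ^+ (_ + 1)]exprD !expr1.
apply: (mulIf w2d0); apply: (mulIf w_neq0).
transitivity (z ^+ (2 * d) * z + y ^+ (2 * d) * w).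
  by field; rewrite ?w_neq0 ?expf_neq0.
transitivity (x * w ^+ (2 * d)); last first.
  by field; rewrite ?w_neq0 ?expf_neq0.
rewrite w_exp2q0 (z_exp2q0 two0 exyt) (y_exp2q0 two0 x y) w_sub.
set X := x ^+ d.
apply: (eq_mod2 two0 (c := y ^+ 2 * z - x * y * z * X + x ^+ 2 * z * X ^+ 2)); ring.
Qed.

End Inversion.

Lemma wfun_invert (A : fieldType) (two0 : 2%:R = 0 :> A) (x y t : A) :
  skabelund_eqs x y t -> wfun x y != 0 ->
  wfun (zfun x y / wfun x y) (y / wfun x y) = (wfun x y)^-1.
Proof.
move=> exyt w0.
rewrite (w_sub two0 (skabelund_invert two0 exyt w0)) (zfun_invert two0 exyt w0).
set z := zfun x y; rewrite expr_div_n.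
have -> : y ^+ 2 / wfun x y ^+ 2 + z / wfun x y * (x / wfun x y) =
   (y ^+ 2 + x * z) / wfun x y ^+ 2 by field.
by rewrite -(w_sub two0 exyt); field.
Qed.

End Exponents.

(** * Normal forms *)

Section NormalForm.
Variable s : nat.
Hypothesis hs : (1 <= s)%N.
Local Notation d := (q0 s).
Local Notation q := (q s).
Local Notation m := (q - 2 * d + 1)%N.
Variables (K : fieldType) (A : comNzRingType) (e : {rmorphism K -> A}).
Variables (x y t : A).
Hypothesis two0 : 2%:R = 0 :> A.
Hypothesis exyt : skabelund_eqs s x y t.
Local Notation z := (zfun s x y).
Local Notation w := (wfun s x y).

Inductive generated : A -> Prop :=
| gen_const c : generated (e c)
| gen_x : generated x
| gen_y : generated y
| gen_t : generated t
| gen_add f g : generated f -> generated g -> generated (f + g)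
| gen_mul f g : generated f -> generated g -> generated (f * g).

Definition exponents : finType := ('I_2 * 'I_d * 'I_m * 'I_d)%type.

Definition monomial (h i j k : nat) : A := y ^+ h * z ^+ i * t ^+ j * w ^+ k.

Definition basis_elt (a : exponents) : A :=
  let: (h, i, j, k) := a in monomial h i j k.

Definition normal_form (C : exponents -> {poly K}) : A :=
  \sum_a (map_poly e (C a)).[x] * basis_elt a.

Definition spanned (f : A) : Prop := exists C, f = normal_form C.

Lemma spanned_add f g : spanned f -> spanned g -> spanned (f + g).
Proof.
move=> [C ->] [D ->]; exists (fun a => C a + D a).
rewrite /normal_form -big_split /=; apply: eq_bigr => a _.
by rewrite rmorphD hornerD mulrDl.
Qed.

Lemma spanned_horner p f : spanned f -> spanned ((map_poly e p).[x] * f).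
Proof.
move=> [C ->]; exists (fun a => p * C a).
rewrite /normal_form mulr_sumr; apply: eq_bigr => a _.
by rewrite rmorphM hornerM mulrA.
Qed.

Lemma spanned_mul_expx n f : spanned f -> spanned (x ^+ n * f).
Proof. by move=> /(spanned_horner 'X^n); rewrite map_polyXn hornerXn. Qed.

Lemma spanned_sum (I : Type) (r : seq I) (G : I -> A) :
  (forall i, spanned (G i)) -> spanned (\sum_(i <- r) G i).
Proof.
move=> sG; elim/big_rec: _ => [|i f _ sf]; last exact: spanned_add.
exists (fun=> 0); rewrite /normal_form big1 // => a _.
by rewrite rmorph0 horner0 mul0r.
Qed.

Lemma spanned_basis_elt a : spanned (basis_elt a).
Proof.
exists (fun b => if b == a then 1 else 0).
rewrite /normal_form (bigD1 a) //= eqxx rmorph1 hornerC mul1r big1 ?addr0 //.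
by move=> b /negPf->; rewrite rmorph0 horner0 mul0r.
Qed.

(* Each of the four rewriting rules for y^2, z^d, w^d and t^m lowers the total
   degree in y, z, t, w. *)
Lemma spanned_monomial h i j k : spanned (monomial h i j k).
Proof.
have d2 := q0_ge2 hs.
have [n] := ubnP (h + i + j + k); elim: n h i j k => // n IH h i j k hn.
have [h2|h2] := ltnP h 2; last first.
  have -> : monomial h i j k =
      monomial (h - 2) i j k.+1 + x ^+ 1 * monomial (h - 2) i.+1 j k.
    rewrite /monomial -{1}(subnK h2) exprD (y_sqr two0 exyt) !exprS; ring.
  by apply: spanned_add; [|apply: spanned_mul_expx]; apply: IH; lia.
have [id|id] := ltnP i d; last first.
  have -> : monomial h i j k =
      monomial h.+1 (i - d) j k + x ^+ d.+1 * monomial h (i - d) j k.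
    rewrite /monomial -{1}(subnK id) exprD (z_expq0 two0 exyt) (exprS y); ring.
  by apply: spanned_add; [|apply: spanned_mul_expx]; apply: IH; lia.
have [kd|kd] := ltnP k d; last first.
  have -> : monomial h i j k =
      monomial h i.+1 j (k - d) + x ^+ d * monomial h.+1 i j (k - d).
    rewrite /monomial -{1}(subnK kd) exprD (w_expq0 hs two0 exyt).
    rewrite (exprS y) (exprS z); ring.
  by apply: spanned_add; [|apply: spanned_mul_expx]; apply: IH; lia.
have [jm|jm] := ltnP j m; last first.
  have -> : monomial h i j k =
      x ^+ q * monomial h i (j - m) k + x ^+ 1 * monomial h i (j - m) k.
    rewrite /monomial -{1}(subnK jm) exprD (proj2 exyt); ring.
  by apply: spanned_add; apply: spanned_mul_expx; apply: IH; lia.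
exact: (spanned_basis_elt (Ordinal h2, Ordinal id, Ordinal jm, Ordinal kd)).
Qed.

(** A product of two basis elements is a monomial with unrestricted exponents, which
    [spanned_monomial] reduces. *)
Lemma spanned_mul f g : spanned f -> spanned g -> spanned (f * g).
Proof.
move=> [C ->] [D ->]; rewrite /normal_form mulr_suml; apply: spanned_sum => a.
rewrite mulr_sumr; apply: spanned_sum => b.
rewrite mulrACA -mulrA; do 2!apply: spanned_horner.
case: a b => [[[h i] j] k] [[[h' i'] j'] k'].
have -> : basis_elt (h, i, j, k) * basis_elt (h', i', j', k') =
    monomial (h + h') (i + i') (j + j') (k + k').
  by rewrite /basis_elt /monomial !exprD; ring.
exact: spanned_monomial.
Qed.

Lemma generated_spanned f : generated f -> spanned f.
Proof.
have sp1 : spanned 1.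
  by have := spanned_monomial 0 0 0 0; rewrite /monomial !expr0 !mulr1.
elim=> [c||||f' g _ + _|f' g _ + _].
- by have := spanned_horner c%:P sp1; rewrite map_polyC hornerC mulr1.
- by have := spanned_mul_expx 1 sp1; rewrite mulr1.
- by have := spanned_monomial 1 0 0 0; rewrite /monomial !expr0 !mulr1.
- by have := spanned_monomial 0 0 1 0; rewrite /monomial !expr0 mulr1 !mul1r.
- exact: spanned_add.
- exact: spanned_mul.
Qed.

Lemma generated_exp f n : generated f -> generated (f ^+ n).
Proof.
move=> gf; elim: n => [|n IH]; last by rewrite exprS; apply: gen_mul.
by rewrite expr0 -(rmorph1 e); apply: gen_const.
Qed.

Lemma generated_opp f : generated f -> generated (- f).
Proof.
move=> gf; rewrite -mulN1r -(rmorph1 e) -rmorphN.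
by apply: gen_mul => //; apply: gen_const.
Qed.

Lemma generated_horner p f : generated f -> generated (map_poly e p).[f].
Proof.
move=> gf; elim/poly_ind: p => [|p c IH].
  by rewrite rmorph0 horner0 -(rmorph0 e); apply: gen_const.
rewrite rmorphD rmorphM /= map_polyX map_polyC hornerMXaddC.
by apply: gen_add; [apply: gen_mul|apply: gen_const].
Qed.

End NormalForm.

(** * Orders and degrees *)

Section Valuation.
Variables (K F : fieldType) (emb : {rmorphism K -> F}) (P : curve_point emb).

Lemma ord_one : P 1 = 0.
Proof. by rewrite -(rmorph1 emb) ordC // oner_neq0. Qed.

Lemma ord_const_ge0 c : 0 <= P (emb c).
Proof.
by have [->|c0] := eqVneq c 0; rewrite ?rmorph0 ?ord_zero ?ordC.
Qed.

Lemma ordX f n : f != 0 -> P (f ^+ n) = n%:Z * P f.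
Proof.
move=> f0; elim: n => [|n IH]; first by rewrite expr0 ord_one mul0r.
by rewrite exprS ordM ?expf_neq0 // IH; lia.
Qed.

Lemma ordV f : f != 0 -> P f^-1 = - P f.
Proof.
move=> f0; have := ordM P f0 (invr_neq0 f0); rewrite divff // ord_one; lia.
Qed.

Lemma ordN f : P (- f) = P f.
Proof.
have [->|f0] := eqVneq f 0; first by rewrite oppr0.
rewrite -mulN1r ordM ?oppr_eq0 ?oner_eq0 //.
by rewrite -(rmorph1 emb) -rmorphN ordC ?oppr_eq0 ?oner_eq0 // add0r.
Qed.

Lemma ordD_lt f g : f != 0 -> P f < P g -> f + g != 0 /\ P (f + g) = P f.
Proof.
move=> f0 lfg; have [->|g0] := eqVneq g 0; first by rewrite addr0.
have fg0 : f + g != 0.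
  by apply: contraTneq lfg => /eqP; rewrite addr_eq0 => /eqP->; rewrite ordN ltxx.
split=> //; apply/eqP; rewrite eq_le; apply/andP; split; last first.
  by have := ordD P f0 g0 fg0; rewrite ge_min => /orP[//|]; lia.
have ng0 : - g != 0 by rewrite oppr_eq0.
(* The ultrametric inequality for f = (f + g) + (-g) gives the reverse bound. *)
have := @ordD _ _ _ P (f + g) (- g) fg0 ng0; rewrite addrK ordN => /(_ f0).
by rewrite ge_min => /orP[//|]; lia.
Qed.

Lemma ord_ge0D f g : 0 <= P f -> 0 <= P g -> 0 <= P (f + g).
Proof.
move=> f0 g0; have [->|nf] := eqVneq f 0; first by rewrite add0r.
have [->|ng] := eqVneq g 0; first by rewrite addr0.
have [->|nfg] := eqVneq (f + g) 0; first by rewrite ord_zero.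
by apply: le_trans (ordD P nf ng nfg); rewrite le_min f0.
Qed.

Lemma ord_ge0M f g : 0 <= P f -> 0 <= P g -> 0 <= P (f * g).
Proof.
move=> f0 g0; have [->|nf] := eqVneq f 0; first by rewrite mul0r ord_zero.
have [->|ng] := eqVneq g 0; first by rewrite mulr0 ord_zero.
by rewrite ordM // addr_ge0.
Qed.

Lemma ord_ge0X f n : 0 <= P f -> 0 <= P (f ^+ n).
Proof.
move=> f0; elim: n => [|n IH]; first by rewrite expr0 ord_one.
by rewrite exprS ord_ge0M.
Qed.

Lemma ord_ge0_generated x y t f :
  0 <= P x -> 0 <= P y -> 0 <= P t -> generated emb x y t f -> 0 <= P f.
Proof.
move=> px py pt; elim=> // [c|f' g _ + _|f' g _ + _]; first exact: ord_const_ge0.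
- exact: ord_ge0D.
- exact: ord_ge0M.
Qed.

(** Terms of pairwise distinct orders cannot cancel, so the least order survives in the sum. Zero
    terms are set apart because [ord] takes the junk value 0 at 0. *)
Lemma ord_sum_distinct (I : eqType) (r : seq I) (G : I -> F) : uniq r ->
  {in r &, forall a b, G a != 0 -> G b != 0 -> P (G a) = P (G b) -> a = b} ->
  {in r, forall a, G a = 0} \/
  exists b, [/\ b \in r, G b != 0, \sum_(a <- r) G a != 0,
    P (\sum_(a <- r) G a) = P (G b) &
    {in r, forall a, G a != 0 -> P (G b) <= P (G a)}].
Proof.
elim: r => [|i r IH] /=; first by left.
move=> /andP[ir ur] inj.
have {IH} := IH ur; rewrite big_cons.
have inj' : {in r &, forall a b, G a != 0 -> G b != 0 -> P (G a) = P (G b) -> a = b}.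
  by move=> a b ar br; apply: inj; rewrite inE ?ar ?br orbT.
move=> /(_ inj')[z0|[b [br Gb s0 eb minb]]].
  have -> : \sum_(a <- r) G a = 0 by rewrite big_seq big1.
  rewrite addr0; have [Gi|Gi] := eqVneq (G i) 0.
    by left=> a; rewrite inE => /orP[/eqP->|/z0].
  right; exists i; split=> // [|a]; rewrite inE ?eqxx //.
  by move=> /orP[/eqP->|/z0->]; rewrite ?eqxx.
have [Gi|Gi] := eqVneq (G i) 0.
  right; exists b; rewrite Gi add0r; split=> //; first by rewrite inE br orbT.
  by move=> a; rewrite inE => /orP[/eqP->|/minb//]; rewrite Gi eqxx.
have neq : P (G i) != P (G b).
  apply: contraNneq ir => e.
  by rewrite (inj i b _ _ Gi Gb e) // inE ?eqxx ?br ?orbT.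
right; have [lt|gt|/eqP] := ltgtP (P (G i)) (P (G b)); last by rewrite (negPf neq).
  exists i; rewrite -eb in lt; have [n0 e] := ordD_lt Gi lt.
  split=> // [|a]; rewrite inE ?eqxx //.
  move=> /orP[/eqP->//|/minb h /h]; rewrite -eb; apply: le_trans; exact: ltW.
exists b; have := gt; rewrite -eb => gt'; have [] := ordD_lt s0 gt'.
rewrite addrC => n0 e; split=> //; rewrite ?e ?eb //; first by rewrite inE br orbT.
by move=> a; rewrite inE => /orP[/eqP-> _|/minb//]; exact: ltW.
Qed.

Lemma ord_horner x p : P x < 0 -> p != 0 ->
  (map_poly emb p).[x] != 0 /\ P (map_poly emb p).[x] = (size p).-1%:Z * P x.
Proof.
move=> x0; have nx : x != 0 by apply: contraTneq x0 => ->; rewrite ord_zero.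
elim/poly_ind: p => [|p c IH]; first by rewrite eqxx.
rewrite rmorphD rmorphM /= map_polyX map_polyC hornerMXaddC size_MXaddC /=.
have [->|p0] := eqVneq p 0.
  rewrite mul0r add0r polyC_eq0 rmorph0 horner0 mul0r add0r => c0.
  by rewrite fmorph_eq0 ordC // (negPf c0) size_poly0 mul0r.
have [n0 e] := IH p0; rewrite /= => _.
have sp : (0 < size p)%N by rewrite size_poly_gt0.
have e' : P ((map_poly emb p).[x] * x) = (size p)%:Z * P x.
  by rewrite ordM // e; move: sp; case: (size p) => //= n _; lia.
have [] := @ordD_lt ((map_poly emb p).[x] * x) (emb c); rewrite ?e' ?mulf_neq0 //.
apply: lt_le_trans (ord_const_ge0 c); nia.
Qed.

(** At a pole of f the term f^n dominates, at a zero the term f does ([ord_expD_zero]). An equation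
    f^q + f = h thus becomes a relation between the orders of f and h. *)
Lemma ord_expD f n : (2 <= n)%N -> P f < 0 ->
  f ^+ n + f != 0 /\ P (f ^+ n + f) = n%:Z * P f.
Proof.
move=> n2 lf; have f0 : f != 0 by apply: contraTneq lf => ->; rewrite ord_zero.
rewrite -ordX //; apply: ordD_lt; rewrite ?expf_neq0 ?ordX //; nia.
Qed.

Lemma ord_expD_pole f n h : (2 <= n)%N -> f ^+ n + f = h -> P h < 0 ->
  P f < 0 /\ n%:Z * P f = P h.
Proof.
move=> n2 <- lh; have lf : P f < 0.
  by rewrite ltNge; apply: contraTN lh => f0; rewrite -leNgt ord_ge0D ?ord_ge0X.
by split=> //; have [] := ord_expD n2 lf.
Qed.

Lemma ord_expD_ge0 f n : (2 <= n)%N -> 0 <= P (f ^+ n + f) -> 0 <= P f.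
Proof.
move=> n2; rewrite !leNgt; apply: contra => lf.
have [_ ->] := ord_expD n2 lf; nia.
Qed.

Lemma ord_expD_zero f n : (2 <= n)%N -> f != 0 -> 0 < P f ->
  f ^+ n + f != 0 /\ P (f ^+ n + f) = P f.
Proof.
by move=> n2 f0 lf; rewrite addrC; apply: ordD_lt => //; rewrite ordX //; nia.
Qed.

End Valuation.

(** * Degrees of the basis monomials and their residues modulo qm *)

Section Degrees.
Variable s : nat.
Hypothesis hs : (1 <= s)%N.
Local Notation d := (q0 s).
Local Notation q := (q s).
Local Notation m := (q - 2 * d + 1)%N.

Definition gen0 := (q * m)%N.

Lemma t_expE : (m + 2 * d = 2 * d * d + 1)%N.
Proof. have := double_q0_lt_q hs; rewrite qE; lia. Qed.

(** This and the next two factorizations show that m divides g_1, g_2 and g_4 = q^2 + 1; hence q^2 =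
    -1 modulo m. *)
Lemma gen1E : gen1 s = ((q + d) * m)%N.
Proof.
have := q0_ge2 hs; have := t_expE; rewrite /gen1 qE.
move: (_ - _ + 1)%N => n; move: d => k e k2.
have -> : n = ((k - 1) * k * 2 + 1)%N by nia.
case: k k2 {e n} => // k _; rewrite subSS subn0 !expnS expn0; nia.
Qed.

Lemma gen2E : gen2 s = ((q + 2 * d) * m)%N.
Proof.
have := q0_ge2 hs; have := t_expE; rewrite /gen2 qE.
move: (_ - _ + 1)%N => n; move: d => k e k2.
have -> : n = ((k - 1) * k * 2 + 1)%N by nia.
case: k k2 {e n} => // k _; rewrite subSS subn0 !expnS expn0; nia.
Qed.

Lemma gen4E : gen4 s = ((q + 2 * d + 1) * m)%N.
Proof.
have := q0_ge2 hs; have := t_expE; rewrite /gen4 qE.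
move: (_ - _ + 1)%N => n; move: d => k e k2.
have -> : n = ((k - 1) * k * 2 + 1)%N by nia.
case: k k2 {e n} => // k _; rewrite subSS subn0 !expnS expn0; nia.
Qed.

Definition degree (h i j k : nat) : nat :=
  (h * gen1 s + i * gen2 s + j * gen3 s + k * gen4 s)%N.

Definition basis_degree (a : exponents s) : nat :=
  let: (h, i, j, k) := a in degree h i j k.

Lemma int_dvd_small (n c r : int) : r = n * c -> - n < r -> r < n -> r = 0.
Proof. move=> -> h1 h2; have : c = 0 by nia. by move->; rewrite mulr0. Qed.

(** A mixed-radix argument. Modulo m only the g_3-term survives, as q^2 = -1 there, and |j - j'| <
    m. After division by m, only the g_4-term survives modulo d; after division by d, what remains
    modulo 2d is h - h' + 2 (i - i'). *)
Lemma basis_degree_inj a b (k l : int) :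
  (basis_degree a)%:Z + gen0%:Z * k = (basis_degree b)%:Z + gen0%:Z * l -> a = b.
Proof.
case: a b => [[[h i] j] e] [[[h' i'] j'] e'].
have hm := t_expE; have d2 := q0_ge2 hs.
move: (ltn_ord h) (ltn_ord i) (ltn_ord j) (ltn_ord e).
move: (ltn_ord h') (ltn_ord i') (ltn_ord j') (ltn_ord e').
rewrite /basis_degree /degree /gen0 gen1E gen2E gen4E /gen3 => he' hj' hi' hh' he hj hi hh eq.
suff [] : [/\ h = h' :> nat, i = i' :> nat, j = j' :> nat & e = e' :> nat].
  by move=> /ord_inj-> /ord_inj-> /ord_inj-> /ord_inj->.
move: eq hm hh hi hj he hh' hi' hj' he'.
move: (nat_of_ord h) (nat_of_ord i) (nat_of_ord j) (nat_of_ord e) => h1 i1 j1 e1.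
move: (nat_of_ord h') (nat_of_ord i') (nat_of_ord j') (nat_of_ord e').
move=> h2 i2 j2 e2 {h i j e h' i' j' e'}.
have := qE s; move: (_ - _ + 1)%N => n; move: (Defs.q s) => Q; move: d d2 => D D2.
move=> -> {Q} eq hm hh hi hj he hh' hi' hj' he'.
have hmz : n%:Z = 2 * D%:Z * D%:Z + 1 - 2 * D%:Z by lia.
have hjj : (j1%:Z - j2%:Z) = 0.
  apply: (@int_dvd_small n%:Z ((2 * D%:Z * D%:Z + 2 * D%:Z + 1) * (j1%:Z - j2%:Z) +
    (h1%:Z - h2%:Z) * (2 * D%:Z * D%:Z + D%:Z) + (i1%:Z - i2%:Z) * (2 * D%:Z * D%:Z + 2 * D%:Z)
    + (e1%:Z - e2%:Z) * (2 * D%:Z * D%:Z + 2 * D%:Z + 1) + 2 * D%:Z * D%:Z * (k - l))); lia.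
have {}eq : (h1%:Z - h2%:Z) * (2 * D%:Z * D%:Z + D%:Z) + (i1%:Z - i2%:Z) * (2 * D%:Z * D%:Z + 2 * D%:Z)
    + (e1%:Z - e2%:Z) * (2 * D%:Z * D%:Z + 2 * D%:Z + 1) + 2 * D%:Z * D%:Z * (k - l) = 0.
  have n0 : n%:Z != 0 by lia.
  have ej : j1 = j2 by lia.
  subst j2; apply: (mulfI n0); lia.
have hee : (e1%:Z - e2%:Z) = 0.
  apply: (@int_dvd_small D%:Z (- ((h1%:Z - h2%:Z) * (2 * D%:Z + 1)
    + (i1%:Z - i2%:Z) * (2 * D%:Z + 2) + (e1%:Z - e2%:Z) * (2 * D%:Z + 2)
    + 2 * D%:Z * (k - l)))); lia.
have {}eq : (h1%:Z - h2%:Z) * (2 * D%:Z + 1) + (i1%:Z - i2%:Z) * (2 * D%:Z + 2)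
    + 2 * D%:Z * (k - l) = 0.
  have n0 : D%:Z != 0 by lia.
  have ej : e1 = e2 by lia.
  subst e2; apply: (mulfI n0); lia.
(* Since |h - h'| <= 1 and |i - i'| <= d - 1, this combination is less than 2d in absolute value;
   once it is 0, parity gives h = h'. *)
have hi0 : (h1%:Z - h2%:Z) + 2 * (i1%:Z - i2%:Z) = 0.
  apply: (@int_dvd_small (2 * D%:Z)
    (- ((h1%:Z - h2%:Z) + (i1%:Z - i2%:Z) + (k - l)))); lia.
by split; lia.
Qed.

End Degrees.

(** * The place at infinity *)

(** Generation of F as a field, stated as an induction principle over subfields S. In this form it
    passes to new coordinates as soon as the old ones are rational expressions in them. *)
Definition field_generated (K F : fieldType) (emb : {rmorphism K -> F}) (x y t : F) :=
  forall S : F -> Prop, (forall c, S (emb c)) -> S x -> S y -> S t ->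
  (forall f g, S f -> S g -> S (f + g)) ->
  (forall f g, S f -> S g -> S (f * g)) ->
  (forall f, S f -> S f^-1) -> forall f, S f.

Lemma field_generated_fraction (K F : fieldType) (emb : {rmorphism K -> F}) (x y t : F) :
  field_generated emb x y t -> forall f, exists p r,
  [/\ generated emb x y t p, generated emb x y t r, r != 0 & f = p / r].
Proof.
move=> gF; have g1 : generated emb x y t 1.
  by rewrite -(rmorph1 emb); apply: gen_const.
have g f : generated emb x y t f -> exists p r,
  [/\ generated emb x y t p, generated emb x y t r, r != 0 & f = p / r].
  by move=> gf; exists f, 1; rewrite oner_neq0 divr1.
apply: gF => [c|||| f1 f2| f1 f2| f1].
- exact/g/gen_const.
- exact/g/gen_x.
- exact/g/gen_y.
- exact/g/gen_t.
- move=> [p1 [r1 [gp1 gr1 r10 ->]]] [p2 [r2 [gp2 gr2 r20 ->]]].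
  exists (p1 * r2 + p2 * r1), (r1 * r2); split; last by rewrite addf_div.
  + by apply: gen_add; apply: gen_mul.
  + exact: gen_mul.
  + exact: mulf_neq0.
- move=> [p1 [r1 [gp1 gr1 r10 ->]]] [p2 [r2 [gp2 gr2 r20 ->]]].
  exists (p1 * p2), (r1 * r2); split; try exact: gen_mul.
  + exact: mulf_neq0.
  + by rewrite mulf_div.
- move=> [p [r [gp gr r0 ->]]]; have [->|p0] := eqVneq p 0.
    exists 0, 1; rewrite oner_neq0 mul0r invr0 mul0r; split=> //.
    by rewrite -(rmorph0 emb); apply: gen_const.
  by exists r, p; rewrite invf_div.
Qed.

Section PlaceAtInfinity.
Variable s : nat.
Hypothesis hs : (1 <= s)%N.
Local Notation d := (q0 s).
Local Notation q := (q s).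
Local Notation m := (q - 2 * d + 1)%N.
Local Notation M := (gen0 s).
Variables (K F : fieldType) (emb : {rmorphism K -> F}) (x y t : F).
Hypothesis two0 : 2%:R = 0 :> F.
Hypothesis exyt : skabelund_eqs s x y t.
Local Notation z := (zfun s x y).
Local Notation w := (wfun s x y).
Implicit Types P Q : curve_point emb.

Lemma q_ge2 : (2 <= q)%N.
Proof. have := q0_ge2 hs; have := double_q0_lt_q hs; lia. Qed.

(** Dominant terms in the equations of y, z, w and t give linear relations between the five orders.
    Over the integers these force divisibility: Bezout relations for the coprime pairs (q, 2d + 1)
    and (q^2, m) extract the factors q and m of the order of x. *)
Lemma pole_orders_multiple Q : Q x < 0 -> exists2 u : int, 0 < u &
  [/\ Q x = - (M%:Z * u), Q y = - ((gen1 s)%:Z * u), Q z = - ((gen2 s)%:Z * u),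
      Q t = - ((gen3 s)%:Z * u) & Q w = - ((gen4 s)%:Z * u)].
Proof.
move=> x0; have q2 := q_ge2; have d2 := q0_ge2 hs; have [ey et] := exyt.
have nx : x != 0 by apply: contraTneq x0 => ->; rewrite ord_zero.
have [D0 Dx] := ord_expD q2 x0.
have [y0 hy] : Q y < 0 /\ q%:Z * Q y = d%:Z * Q x + q%:Z * Q x.
  have e : Q (x ^+ d * (x ^+ q + x)) = d%:Z * Q x + q%:Z * Q x.
    by rewrite ordM ?expf_neq0 // ordX // Dx.
  by rewrite -e; apply: (ord_expD_pole q2 ey); rewrite e; nia.
have ny : y != 0 by apply: contraTneq y0 => ->; rewrite ord_zero.
have [z0 hz] : Q z < 0 /\ q%:Z * Q z = 2 * d%:Z * Q x + q%:Z * Q x.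
  have e : Q ((x ^+ d) ^+ 2 * (x ^+ q + x)) = 2 * d%:Z * Q x + q%:Z * Q x.
    by rewrite ordM ?expf_neq0 // !ordX ?expf_neq0 // Dx; lia.
  rewrite -e; apply: (ord_expD_pole q2 (z_eq hs two0 exyt)); rewrite e; nia.
have [w0 hw] : Q w < 0 /\ q%:Z * Q w = 2 * d%:Z * Q y + q%:Z * Q x.
  have e : Q (y ^+ (2 * d) * (x ^+ q + x)) = 2 * d%:Z * Q y + q%:Z * Q x.
    by rewrite ordM ?expf_neq0 // ordX // Dx; lia.
  rewrite -e; apply: (ord_expD_pole q2 (w_eq hs two0 exyt)); rewrite e; nia.
have nt : t != 0.
  by apply: contraNneq D0 => t0; rewrite -et t0 expr0n addn1.
have ht : m%:Z * Q t = q%:Z * Q x by rewrite -Dx -et ordX.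
have := t_expE hs; have := qE s; rewrite /gen0 gen1E // gen2E // gen4E // /gen3.
move: (Q x) (Q y) (Q z) (Q w) (Q t) x0 {y0 z0 w0 Dx} hy hz hw ht => X Y Z W T x0.
move: (_ - _ + 1)%N => n; move: (Defs.q s) => qq.
move=> hy hz hw ht eq hm.
have eqz : qq%:Z = 2 * d%:Z * d%:Z by lia.
have hmz : n%:Z = 2 * d%:Z * d%:Z + 1 - 2 * d%:Z by lia.
have d0 : d%:Z != 0 by lia.
have n0 : n%:Z != 0 by nia.
have d_ge0 : 0 <= d%:Z by [].
rewrite expnS expn1 !(PoszD, PoszM) eqz {eq hm}.
move: (d%:Z) eqz hmz d0 d_ge0 hy hz hw ht => D eqz hmz d0 d_ge0 hy hz hw ht.
rewrite eqz in hy hz hw ht.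
pose a := W - X.
have eY : Y = D * a.
  apply: (mulfI (_ : 2 * D != 0)); first by lia.
  rewrite /a; lia.
have ea : 2 * D * D * a = (1 + 2 * D) * X.
  by apply: (mulfI d0); rewrite eY in hy; lia.
(* The Bezout relation is (1 - 2d)(1 + 2d) + 2q = 1. *)
pose b := (1 - 2 * D) * a + 2 * X.
have eb : X = 2 * D * D * b.
  by have := congr1 ( *%R (1 - 2 * D)) ea; rewrite /b; lia.
have eab : a = (1 + 2 * D) * b.
  have dd0 : 2 * D * D != 0 by rewrite mulf_neq0 // mulf_neq0.
  by apply: (mulfI dd0); rewrite ea {1}eb; lia.
(* The Bezout relation is (q + 2d + 1) m - q^2 = 1. *)
pose c := (2 * D * D + 2 * D + 1) * b - T.
have ec : b = n%:Z * c.
  have hT : n%:Z * T = 2 * D * D * (2 * D * D) * b by rewrite ht eb; lia.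
  have -> : n%:Z * c = n%:Z * (2 * D * D + 2 * D + 1) * b - n%:Z * T.
    by rewrite /c; lia.
  by rewrite hT hmz; lia.
have eW : W = a + X by rewrite /a; lia.
have eT : T = 2 * D * D * (2 * D * D) * c.
  by apply: (mulfI n0); rewrite ht eb ec; lia.
have eZ : Z = (2 * D * D + 2 * D) * n%:Z * c.
  have dd0 : 2 * D * D != 0 by rewrite mulf_neq0 // mulf_neq0.
  by apply: (mulfI dd0); rewrite hz eb ec; lia.
exists (- c).
  rewrite oppr_gt0 ltNge; apply: contraTN x0 => c0.
  by rewrite -leNgt eb ec !mulr_ge0.
split.
- by rewrite eb ec; lia.
- rewrite eY eab ec; lia.
- rewrite eZ; lia.
- rewrite eT; lia.
- rewrite eW eab eb ec; lia.
Qed.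

Local Notation nf := (@normal_form s K F emb x y t).
Local Notation bdeg := (@basis_degree s).

Definition nf_degree (C : exponents s -> {poly K}) : nat :=
  \max_(a | C a != 0) (bdeg a + M * (size (C a)).-1).

Lemma ord_basis_elt Q (u : int) a :
  [/\ Q x = - (M%:Z * u), Q y = - ((gen1 s)%:Z * u), Q z = - ((gen2 s)%:Z * u),
      Q t = - ((gen3 s)%:Z * u) & Q w = - ((gen4 s)%:Z * u)] ->
  0 < u -> basis_elt x y t a != 0 /\ Q (basis_elt x y t a) = - ((bdeg a)%:Z * u).
Proof.
move=> [Qx Qy Qz Qt Qw] u0.
have nz f g : (0 < g)%N -> Q f = - (g%:Z * u) -> f != 0.
  by move=> g0 ef; apply/eqP => f0; move: ef; rewrite f0 ord_zero; nia.
have q2 := q_ge2; have d2 := q0_ge2 hs; have hm := t_expE hs.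
have ny : y != 0 by apply: nz Qy; rewrite gen1E //; nia.
have nz' : z != 0 by apply: nz Qz; rewrite gen2E //; nia.
have nt : t != 0 by apply: nz Qt; rewrite /gen3; nia.
have nw : w != 0 by apply: nz Qw; rewrite gen4E //; nia.
case: a => [[[h i] j] k]; rewrite /basis_elt /monomial /basis_degree /degree.
rewrite !mulf_neq0 ?expf_neq0 // !ordM ?mulf_neq0 ?expf_neq0 // !ordX //.
rewrite Qy Qz Qt Qw; split=> //; lia.
Qed.

(** By [basis_degree_inj] the nonzero terms have distinct orders, so the term of largest degree
    gives the order of the sum. The factor [u] comes from [pole_orders_multiple] and is determined
    only in [place_at_infinity]. *)
Lemma ord_normal_form Q C : Q x < 0 -> (exists a, C a != 0) ->
  exists2 u : int, 0 < u & [/\ Q x = - (M%:Z * u), nf C != 0, Q (nf C) = - ((nf_degree C)%:Z * u) &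
  exists2 a, C a != 0 & nf_degree C = (bdeg a + M * (size (C a)).-1)%N].
Proof.
move=> x0 [a0 Ca0]; have [u u0 hu] := pole_orders_multiple x0; exists u => //.
have Qx : Q x = - (M%:Z * u) by case: hu.
have term a : C a != 0 ->
  (map_poly emb (C a)).[x] * basis_elt x y t a != 0 /\
  Q ((map_poly emb (C a)).[x] * basis_elt x y t a) =
    - ((bdeg a + M * (size (C a)).-1)%N%:Z * u).
  move=> Ca; have [c0 ec] := ord_horner x0 Ca; have [b0 eb] := ord_basis_elt a hu u0.
  by split; [rewrite mulf_neq0|rewrite ordM // ec eb Qx; lia].
have term0 a : (map_poly emb (C a)).[x] * basis_elt x y t a != 0 -> C a != 0.
  by apply: contraNneq => ->; rewrite rmorph0 horner0 mul0r.
have := @ord_sum_distinct K F emb Q (exponents s) (index_enum _)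
  (fun a => (map_poly emb (C a)).[x] * basis_elt x y t a) (index_enum_uniq _).
case.
- move=> a b _ _ /term0 Ca /term0 Cb.
  rewrite (proj2 (term a Ca)) (proj2 (term b Cb)) => e.
  apply: (@basis_degree_inj s hs a b (size (C a)).-1%:Z (size (C b)).-1%:Z).
  by apply: (mulIf (lt0r_neq0 u0)); lia.
- by move=> /(_ a0 (mem_index_enum _)) /eqP; have [/negPf->] := term a0 Ca0.
move=> [b [_ /term0 Cb n0 eb minb]].
have deg : nf_degree C = (bdeg b + M * (size (C b)).-1)%N.
  apply/eqP; rewrite eqn_leq; apply/andP; split; last first.
    by rewrite /nf_degree (leq_bigmax_cond b Cb).
  apply/bigmax_leqP => a Ca; have [ta ea] := term a Ca.
  have := minb a (mem_index_enum _) ta; rewrite ea (proj2 (term b Cb)).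
  by rewrite lerN2 ler_pM2r // lez_nat.
split=> //; last by exists b.
by rewrite /normal_form eb (proj2 (term b Cb)) deg.
Qed.

Lemma generated_ord Q f : Q x < 0 -> generated emb x y t f -> f != 0 ->
  exists C, f = nf C /\ exists a, C a != 0.
Proof.
move=> x0 gf f0; have [C eC] := generated_spanned hs two0 exyt gf.
exists C; split=> //; apply: contrapT => nC.
have C0 a : C a = 0 by apply/eqP; apply: contrapT => /negP h; apply: nC; exists a.
move: f0; rewrite eC /normal_form big1 ?eqxx // => a _.
by rewrite C0 rmorph0 horner0 mul0r.
Qed.

Hypothesis gF : field_generated emb x y t.

(* On the subring of normal forms all such places agree up to a positive factor,
   which the existence of a uniformizer forces to be 1. *)
Lemma place_at_infinity Q : Q x < 0 ->
  Q x = - M%:Z /\ forall C, (exists a, C a != 0) ->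
  nf C != 0 /\ Q (nf C) = - (nf_degree C)%:Z.
Proof.
move=> x0; have [f f0 f1] := ord_uniformizer Q.
have [p [r [gp gr r0 ef]]] := field_generated_fraction gF f.
have p0 : p != 0 by apply: contraNneq f0 => p0; rewrite ef p0 mul0r.
have [C [eC nC]] := generated_ord x0 gp p0.
have [D [eD nD]] := generated_ord x0 gr r0.
have Mne : M%:Z != 0.
  have := q_ge2; rewrite /gen0; have := t_expE hs; have := double_q0_lt_q hs; nia.
have uniq (u v : int) : Q x = - (M%:Z * u) -> Q x = - (M%:Z * v) -> u = v.
  by move=> -> /oppr_inj /(mulfI Mne).
have [u u0 [Qx _ QC _]] := ord_normal_form x0 nC.
have [v v0 [Qx' _ QD _]] := ord_normal_form x0 nD.
have e := uniq _ _ Qx Qx'; subst v.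
(* The uniformizer is a quotient of two normal forms, so its order 1 is a multiple of [u]. *)
have : Q f = ((nf_degree D)%:Z - (nf_degree C)%:Z) * u.
  rewrite ef ordM ?invr_eq0 // ordV // {1}eC {1}eD QC QD; lia.
have unit1 (n k : int) : 0 < k -> 1 = n * k -> k = 1.
  move=> k0 e; have n0 : 0 < n by rewrite -(pmulr_lgt0 _ k0) -e.
  by nia.
rewrite f1 => /(unit1 _ _ u0) u1.
subst u; split=> [|E nE]; first by rewrite Qx mulr1.
have [v v0' [Qx'' nfE QE _]] := ord_normal_form x0 nE.
by have e := uniq _ _ Qx Qx''; subst v; rewrite QE mulr1.
Qed.

(** Both valuations are minus the degree on normal forms, and quotients of normal forms exhaust
    F. *)
Lemma place_at_infinity_unique P Q : P x < 0 -> Q x < 0 -> Q = P.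
Proof.
move=> Px Qx; have [_ hP] := place_at_infinity Px; have [_ hQ] := place_at_infinity Qx.
apply: curve_point_ext => f; have [->|f0] := eqVneq f 0; first by rewrite !ord_zero.
have [p [r [gp gr r0 ef]]] := field_generated_fraction gF f.
have p0 : p != 0 by apply: contraNneq f0 => p0; rewrite ef p0 mul0r.
have [C [eC nC]] := generated_ord Px gp p0.
have [D [eD nD]] := generated_ord Px gr r0.
have [_ PC] := hP C nC; have [_ QC] := hQ C nC.
have [_ PD] := hP D nD; have [_ QD] := hQ D nD.
rewrite ef !ordM ?invr_eq0 // !ordV // eC eD.
by rewrite PC PD QC QD.
Qed.

End PlaceAtInfinity.

(** * Affine places *)

Lemma rmorph_generated (K : fieldType) (A B : comNzRingType) (e : {rmorphism K -> A})
    (e' : {rmorphism K -> B}) (g : {rmorphism A -> B}) (x y t f : A) :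
  (forall c, g (e c) = e' c) ->
  generated e x y t f -> generated e' (g x) (g y) (g t) (g f).
Proof.
move=> ge; elim=> [c||||f1 f2 _ IH1 _ IH2|f1 f2 _ IH1 _ IH2].
- by rewrite ge; apply: gen_const.
- exact: gen_x.
- exact: gen_y.
- exact: gen_t.
- by rewrite rmorphD; apply: gen_add.
- by rewrite rmorphM; apply: gen_mul.
Qed.

Lemma rmorph_normal_form (s : nat) (K : fieldType) (A B : comNzRingType)
    (e : {rmorphism K -> A}) (e' : {rmorphism K -> B}) (g : {rmorphism A -> B})
    (x y t : A) (C : exponents s -> {poly K}) :
  (forall c, g (e c) = e' c) ->
  g (normal_form e x y t C) = normal_form e' (g x) (g y) (g t) C.
Proof.
move=> ge; rewrite /normal_form rmorph_sum; apply: eq_bigr => -[[[h i] j] k] _.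
rewrite rmorphM -horner_map -map_poly_comp; congr (_.[_] * _).
  by apply: eq_map_poly => c; apply: ge.
by rewrite /= /monomial /wfun /zfun !(rmorphM, rmorphXn, rmorphD).
Qed.

(** Elements of [I] may lie outside K[x, y, t]: the definition is also applied to [tau_multiple], a
    subset of a local ring. *)
Definition generated_ideal (K F : fieldType) (emb : {rmorphism K -> F}) (x y t : F)
    (I : F -> Prop) : Prop :=
  (forall f g, I f -> I g -> I (f + g)) /\
  (forall f g, I f -> generated emb x y t g -> I (f * g)).

Lemma generated_subX (K F : fieldType) (emb : {rmorphism K -> F}) (x y t u v : F) n :
  generated emb x y t u -> generated emb x y t v ->
  exists2 r, generated emb x y t r & u ^+ n - v ^+ n = (u - v) * r.
Proof.
move=> gu gv; rewrite subrXX; eexists; last by [].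
elim/big_rec: _ => [|i f _ gf]; first by rewrite -(rmorph0 emb); apply: gen_const.
by apply: gen_add gf; apply: gen_mul; apply: generated_exp.
Qed.

Section GraphEmbedding.
Variables (K F : fieldType) (emb : {rmorphism K -> F}).

(** This makes F * K a K-algebra, in which (x, a), (y, b) and (t, c) generate the graph of
    evaluation at (a, b, c). *)
Definition graph_emb (c : K) : F * K := (emb c, c).

Fact graph_emb_zmod : zmod_morphism graph_emb.
Proof. by move=> c c'; rewrite /graph_emb rmorphB. Qed.

Fact graph_emb_monoid : monoid_morphism graph_emb.
Proof. by split=> [|c c']; rewrite /graph_emb ?rmorph1 ?rmorphM. Qed.

HB.instance Definition _ := GRing.isZmodMorphism.Build _ _ graph_emb graph_emb_zmod.
HB.instance Definition _ := GRing.isMonoidMorphism.Build _ _ graph_emb graph_emb_monoid.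

End GraphEmbedding.

(** * Integrality over K[t] *)

Section Norm.
Variables (K F : fieldType) (emb : {rmorphism K -> F}) (x y t : F).

Let inKt : {rmorphism {poly K} -> F} := horner_eval t \o map_poly emb.

Lemma integral_expD (n : nat) (f h : F) : (2 <= n)%N ->
  integralOver inKt h -> f ^+ n + f = h -> integralOver inKt f.
Proof.
move=> n2 ih e.
have sz : (size ('X - h%:P : {poly F})%R < size ('X^n : {poly F})%R)%N.
  by rewrite size_XsubC size_polyXn.
apply: (@integral_root_monic _ _ _ _ ('X^n + ('X - h%:P))).
- by rewrite monicE lead_coefDl // lead_coefXn.
- by rewrite /root !(hornerD, hornerN, hornerXn, hornerX, hornerC) addrA e subrr.
- apply/integral_poly => i; rewrite !coefE.
  apply: integral_add; first exact: integral_nat.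
  apply: integral_sub; first exact: integral_nat.
  by case: ifP => _ //; apply: integral0.
Qed.

Variable s : nat.
Hypothesis hs : (1 <= s)%N.
Hypothesis exyt : skabelund_eqs s x y t.

Lemma generated_integral f : generated emb x y t f -> integralOver inKt f.
Proof.
have q2 := q_ge2 hs; have [ey et] := exyt.
have integral_exp g n : integralOver inKt g -> integralOver inKt (g ^+ n).
  move=> ig; elim: n => [|n IH]; first exact: integral1.
  by rewrite exprS; apply: integral_mul.
have it : integralOver inKt t.
  by have := integral_id inKt 'X; rewrite /= /horner_eval map_polyX hornerX.
have ix : integralOver inKt x.
  by apply: (integral_expD q2 _ (esym et)); apply: integral_exp.
have iy : integralOver inKt y.
  by apply: (integral_expD q2 _ ey); rewrite -et; apply: integral_mul; apply: integral_exp.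
elim=> // [c|f1 f2 _ IH1 _ IH2|f1 f2 _ IH1 _ IH2].
- by have := integral_id inKt c%:P; rewrite /= /horner_eval map_polyC hornerC.
- exact: integral_add.
- exact: integral_mul.
Qed.

(** In an equation G(p) = 0 with G monic over K[t], a zero constant coefficient can be divided out,
    as p is nonzero. Otherwise G = H X + c with c nonzero, and c = -p H(p) is a multiple of p; it
    plays the part of the norm of p. *)
Lemma generated_norm p : generated emb x y t p -> p != 0 ->
  exists p' N, [/\ generated emb x y t p', N != 0 & p * p' = (map_poly emb N).[t]].
Proof.
move=> gp p0; have [G mG rG] := generated_integral gp.
have genR N : generated emb x y t (inKt N).
  by apply: generated_horner; apply: gen_t.
suff: exists p' N, [/\ generated emb x y t p', N != 0 & p * p' = inKt N] by [].
move: (inKt) rG genR => r rG genR.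
have genH (H : {poly {poly K}}) : generated emb x y t (map_poly r H).[p].
  elim/poly_ind: H => [|H c IH].
    by rewrite rmorph0 horner0 -(rmorph0 emb); apply: gen_const.
  rewrite rmorphD rmorphM /= map_polyX map_polyC hornerMXaddC.
  by apply: gen_add; [apply: gen_mul|apply: genR].
have {mG} G0 : G != 0 by apply: monic_neq0.
elim/poly_ind: G G0 rG => [|H c IH]; first by rewrite eqxx.
rewrite /root rmorphD rmorphM /= map_polyX map_polyC hornerMXaddC.
have [->|c0] := eqVneq c 0.
  rewrite !raddf0 !addr0 => HX0; rewrite mulf_eq0 (negPf p0) orbF.
  by apply: IH; apply: contraNneq HX0 => ->; rewrite mul0r.
move=> _ e; exists (- (map_poly r H).[p]), c; split=> //.
  exact/generated_opp/genH.
by move: e; rewrite addr_eq0 => /eqP e; rewrite mulrN mulrC e opprK.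
Qed.

End Norm.

(** * The local ring at an affine point (a, b, c) and its valuation *)

Section AffinePlace.
Variable s : nat.
Hypothesis hs : (1 <= s)%N.
Local Notation d := (q0 s).
Local Notation q := (q s).
Local Notation m := (q - 2 * d + 1)%N.
Variables (K F : fieldType) (emb : {rmorphism K -> F}) (x y t : F).
Hypothesis two0 : 2%:R = 0 :> F.
Hypothesis exyt : skabelund_eqs s x y t.
Hypothesis gF : field_generated emb x y t.
Variable P : curve_point emb.
Hypothesis Px : P x < 0.
Variables (a b c : K).
Hypothesis eabc : skabelund_eqs s a b c.

Local Notation gen := (generated emb x y t).

(* The element f of K[x, y, t] takes the value u at (a, b, c): a graph, since
   evaluation is only known to be well defined after [value_of_uniq]. *)
Definition value_of (f : F) (u : K) : Prop :=
  generated (graph_emb emb) (x, a) (y, b) (t, c) (f, u).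

Lemma value_of_generated f u : value_of f u -> gen f.
Proof. by move=> /(@rmorph_generated _ _ _ _ emb fst); apply. Qed.

Lemma generated_value_of f : gen f -> exists u, value_of f u.
Proof.
elim=> [k||||f1 f2 _ [u1 IH1] _ [u2 IH2]|f1 f2 _ [u1 IH1] _ [u2 IH2]].
- by exists k; apply: (@gen_const _ _ (graph_emb emb)).
- by exists a; apply: gen_x.
- by exists b; apply: gen_y.
- by exists c; apply: gen_t.
- by exists (u1 + u2); apply: (gen_add IH1 IH2).
- by exists (u1 * u2); apply: (gen_mul IH1 IH2).
Qed.

Lemma value_of_const k : value_of (emb k) k.
Proof. exact: (@gen_const _ _ (graph_emb emb)). Qed.

Lemma value_ofD f g u v : value_of f u -> value_of g v -> value_of (f + g) (u + v).
Proof. exact: gen_add. Qed.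

Lemma value_ofM f g u v : value_of f u -> value_of g v -> value_of (f * g) (u * v).
Proof. exact: gen_mul. Qed.

Lemma value_ofN f u : value_of f u -> value_of (- f) (- u).
Proof. exact: generated_opp. Qed.

Lemma value_ofX f u n : value_of f u -> value_of (f ^+ n) (u ^+ n).
Proof.
move=> fu; elim: n => [|n IH]; last by rewrite !exprS; apply: value_ofM.
by rewrite !expr0 -(rmorph1 emb); apply: value_of_const.
Qed.

(* The normal form of an element of F * K shows that a vanishing first component
   forces all coefficients, hence the second component, to vanish. *)
Lemma value_of_uniq f u v : value_of f u -> value_of f v -> u = v.
Proof.
move=> fu fv; have := value_ofD fu (value_ofN fv).
rewrite subrr => h; apply/eqP; rewrite -subr_eq0; move: (u - v) h => k h {fu fv}.
have two0K : 2%:R = 0 :> K by apply: (fmorph_inj emb); rewrite rmorph_nat rmorph0.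
have two0' : 2%:R = 0 :> (F * K)%type by congr (_, _).
have e' : skabelund_eqs s ((x, a) : F * K) (y, b) (t, c).
  have [ex et] := exyt; have [ea ec] := eabc.
  by split; apply: injective_projections; rewrite /= ?(rmorphD, rmorphM, rmorphXn).
have [C eC] := generated_spanned hs two0' e' h.
have e1 : 0 = normal_form emb x y t C.
  by rewrite -[LHS]/(fst (0 : F, k)) eC (@rmorph_normal_form _ _ _ _ _ emb).
have e2 : k = normal_form idfun a b c C.
  by rewrite -[LHS]/(snd (0 : F, k)) eC (@rmorph_normal_form _ _ _ _ _ idfun).
have C0 a' : C a' = 0.
  apply/eqP; apply: contrapT => /negP Ca.
  have [_ /(_ C)] := place_at_infinity hs two0 exyt gF Px.
  by rewrite -e1 eqxx => -[]//; exists a'.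
by rewrite e2 /normal_form big1 // => a' _; rewrite C0 rmorph0 horner0 mul0r.
Qed.

Lemma ideal_sub_value I f u : generated_ideal emb x y t I ->
  I (x - emb a) -> I (y - emb b) -> I (t - emb c) -> value_of f u -> I (f - emb u).
Proof.
move=> [ID IM] Ix Iy It fu.
(* The induction on [generated] builds a value of its own, which [value_of_uniq] identifies with
   [u]. *)
suff [u' [fu' Iu']] : exists u', value_of f u' /\ I (f - emb u').
  by rewrite (value_of_uniq fu fu').
have := value_of_generated fu.
elim=> {f u fu} [k||||f1 f2 g1 [u1 [v1 IH1]] g2 [u2 [v2 IH2]]|f1 f2 g1 [u1 [v1 IH1]] g2 [u2 [v2 IH2]]].
- exists k; split; first exact: value_of_const.
  by rewrite subrr -(mulr0 (x - emb a)) -(rmorph0 emb); apply: IM => //; apply: gen_const.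
- by exists a; split; first exact: gen_x.
- by exists b; split; first exact: gen_y.
- by exists c; split; first exact: gen_t.
- exists (u1 + u2); split; first exact: value_ofD.
  by rewrite rmorphD opprD addrACA; apply: ID.
- exists (u1 * u2); split; first exact: value_ofM.
  have -> : f1 * f2 - emb (u1 * u2) = (f1 - emb u1) * f2 + (f2 - emb u2) * emb u1.
    by rewrite rmorphM; ring.
  by apply: ID; apply: IM => //; apply: gen_const.
Qed.

Lemma value_of_neq0 f u : value_of f u -> u != 0 -> f != 0.
Proof.
move=> fu; apply: contraNneq => f0; apply/eqP.
by apply: value_of_uniq fu _; rewrite f0 -(rmorph0 emb); apply: value_of_const.
Qed.

(** The graph of evaluation on the local ring of the curve at (a, b, c). *)
Definition local_value (f : F) (v : K) : Prop := exists p r u w,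
  [/\ value_of p u, value_of r w, w != 0, f = p / r & v = u / w].

Lemma local_value_uniq f u v : local_value f u -> local_value f v -> u = v.
Proof.
move=> [p [r [u1 [w1 [pu rw w0 -> ->]]]]] [p' [r' [u2 [w2 [pu' rw' w0' e ->]]]]].
apply/eqP; rewrite eqr_div //; apply/eqP.
have r0 := value_of_neq0 rw w0; have r0' := value_of_neq0 rw' w0'.
move/eqP: e; rewrite eqr_div // => /eqP e.
by apply: (@value_of_uniq (p * r')); [|rewrite e]; apply: value_ofM.
Qed.

Lemma value_of_local f u : value_of f u -> local_value f u.
Proof.
move=> fu; exists f, 1, u, 1; rewrite oner_neq0 !divr1; split=> //.
by rewrite -(rmorph1 emb); apply: value_of_const.
Qed.

Lemma local_value_const k : local_value (emb k) k.
Proof. exact/value_of_local/value_of_const. Qed.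

Lemma local_valueD f g u v : local_value f u -> local_value g v ->
  local_value (f + g) (u + v).
Proof.
move=> [p [r [u1 [w1 [pu rw w0 -> ->]]]]] [p' [r' [u2 [w2 [pu' rw' w0' -> ->]]]]].
have r0 := value_of_neq0 rw w0; have r0' := value_of_neq0 rw' w0'.
exists (p * r' + p' * r), (r * r'), (u1 * w2 + u2 * w1), (w1 * w2).
by split; rewrite ?mulf_neq0 ?addf_div //; try apply: value_ofD; apply: value_ofM.
Qed.

Lemma local_valueM f g u v : local_value f u -> local_value g v ->
  local_value (f * g) (u * v).
Proof.
move=> [p [r [u1 [w1 [pu rw w0 -> ->]]]]] [p' [r' [u2 [w2 [pu' rw' w0' -> ->]]]]].
exists (p * p'), (r * r'), (u1 * u2), (w1 * w2).
by split; rewrite ?mulf_neq0 ?mulf_div //; apply: value_ofM.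
Qed.

Lemma local_valueV f v : local_value f v -> v != 0 -> local_value f^-1 v^-1.
Proof.
move=> [p [r [u1 [w1 [pu rw w0 -> ->]]]]] v0.
exists r, p, w1, u1; rewrite !invf_div; split=> //.
by apply: contraNneq v0 => ->; rewrite mul0r.
Qed.

Local Notation tau := (t - emb c).

Lemma local_value_tau : local_value tau 0.
Proof.
rewrite -(subrr c) -rmorphN; apply/value_of_local/value_ofD; first exact: gen_t.
exact: value_of_const.
Qed.

Definition tau_multiple f := exists g v, f = tau * g /\ local_value g v.

Lemma tau_multipleD f g : tau_multiple f -> tau_multiple g -> tau_multiple (f + g).
Proof.
move=> [f1 [u [-> hf]]] [g1 [v [-> hg]]]; exists (f1 + g1), (u + v).
by split; [rewrite mulrDr|apply: local_valueD].
Qed.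

Lemma tau_multipleM f g u : tau_multiple f -> local_value g u -> tau_multiple (f * g).
Proof.
move=> [f1 [v [-> hf]]] hg; exists (f1 * g), (v * u).
by split; [rewrite mulrA|apply: local_valueM].
Qed.

(* (f - k)(1 + (f - k)^(q - 1)) = h, and the second factor is a unit. *)
Lemma tau_multiple_expD f k h : value_of f k ->
  (f - emb k) ^+ q + (f - emb k) = h -> tau_multiple h -> tau_multiple (f - emb k).
Proof.
move=> fk e th; have q2 := q_ge2 hs.
have fk0 : value_of (f - emb k) 0.
  by rewrite -(subrr k) -rmorphN; apply: value_ofD => //; apply: value_of_const.
have h1 : value_of ((f - emb k) ^+ q.-1 + 1) 1.
  have := value_ofD (value_ofX q.-1 fk0) (value_of_const 1).
  by rewrite rmorph1 expr0n -(subnK q2) addn2 /= add0r.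
have n0 := value_of_neq0 h1 (oner_neq0 _).
have -> : f - emb k = h / ((f - emb k) ^+ q.-1 + 1).
  by apply: (mulIf n0); rewrite divfK // -e mulrDr mulr1 -exprS prednK //; lia.
apply: tau_multipleM th _; apply: local_valueV (oner_neq0 _).
exact: value_of_local h1.
Qed.

Lemma tau_multiple_t : tau_multiple tau.
Proof.
exists 1, 1; rewrite mulr1; split=> //.
by rewrite -{1}(rmorph1 emb); apply: local_value_const.
Qed.

Lemma generated_tau_multiple f g : tau_multiple f -> gen g -> tau_multiple (f * g).
Proof.
by move=> hf /generated_value_of[u /value_of_local]; apply: tau_multipleM.
Qed.

Lemma tau_multiple_expt : tau_multiple (t ^+ m - emb c ^+ m).
Proof.
have [r gr ->] := generated_subX m (gen_t emb x y t) (gen_const emb x y t c).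
exact: generated_tau_multiple tau_multiple_t gr.
Qed.

(** Subtracting the equation at (a, b, c) gives (x - a)^q + (x - a) = t^m - c^m, which [tau]
    divides. Geometrically, the covering of the t-line is unramified at affine points. *)
Lemma tau_multiple_x : tau_multiple (x - emb a).
Proof.
apply: (tau_multiple_expD (gen_x _ _ _ _) erefl).
suff -> : (x - emb a) ^+ q + (x - emb a) = t ^+ m - emb c ^+ m.
  exact: tau_multiple_expt.
rewrite -(rmorphXn emb) (proj2 exyt) (proj2 eabc) !(oppr_mod2 two0).
by rewrite (exprD_q s two0) rmorphD rmorphXn addrACA.
Qed.

Lemma tau_multiple_y : tau_multiple (y - emb b).
Proof.
apply: (tau_multiple_expD (gen_y _ _ _ _) erefl).
(* The right side is x^d t^m - a^d c^m, split so that each summand has a factor already known to be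
   a multiple of [tau]. *)
have -> : (y - emb b) ^+ q + (y - emb b) =
    (t ^+ m - emb c ^+ m) * x ^+ d + (x - emb a) * ((x - emb a) ^+ d.-1 * emb c ^+ m).
  rewrite mulrA -exprS prednK; last by have := q0_ge2 hs; lia.
  rewrite !(oppr_mod2 two0) (exprD_q s two0) (exprD_q0 s two0) addrACA -!rmorphXn -rmorphD.
  have [ea ec] := eabc; have [ex et] := exyt.
  rewrite ex -et ea -ec rmorphM !rmorphXn.
  by apply: (eq_mod2 two0 (c := - (emb c ^+ m * x ^+ d))); ring.
apply: tau_multipleD; first exact/(generated_tau_multiple tau_multiple_expt)/generated_exp/gen_x.
apply: (generated_tau_multiple tau_multiple_x); apply: gen_mul.
  apply: generated_exp; apply: gen_add (gen_x _ _ _ _) _.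
  exact/generated_opp/gen_const.
exact/generated_exp/gen_const.
Qed.

(** The maximal ideal of the local ring is generated by [tau]: a numerator of value 0 lies in any
    ideal containing x - a, y - b and [tau], and the first two are multiples of the third. *)
Lemma local_value0 f : local_value f 0 -> tau_multiple f.
Proof.
move=> [p [r [u [w [pu rw w0 -> /esym /eqP]]]]].
rewrite mulf_eq0 invr_eq0 (negPf w0) orbF => /eqP u0.
have iT : generated_ideal emb x y t tau_multiple.
  by split=> [f1 f2|f1 f2]; [apply: tau_multipleD|apply: generated_tau_multiple].
have := ideal_sub_value iT tau_multiple_x tau_multiple_y tau_multiple_t pu.
rewrite u0 rmorph0 subr0 => tp; exact: tau_multipleM tp (local_valueV (value_of_local rw) w0).
Qed.

Definition regular_value f := exists v, local_value f v.

Definition local_unit f := exists2 v, v != 0 & local_value f v.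

Lemma tau_neq0 : tau != 0.
Proof.
have m0 : (0 < m)%N by rewrite addn1.
(* If t were the constant c, then x^q + x would be constant and x regular at P. *)
apply: contraTneq Px => /eqP; rewrite subr_eq0 => /eqP et.
rewrite -leNgt; apply: (ord_expD_ge0 (q_ge2 hs)).
by rewrite -(proj2 exyt) et; apply/ord_ge0X/ord_const_ge0.
Qed.

Lemma local_unitV f : local_unit f -> local_unit f^-1.
Proof. by move=> [v v0 fv]; exists v^-1; rewrite ?invr_eq0 //; apply: local_valueV. Qed.

Lemma local_unitM f g : local_unit f -> local_unit g -> local_unit (f * g).
Proof.
move=> [v v0 fv] [w w0 gw]; exists (v * w); first exact: mulf_neq0.
exact: local_valueM.
Qed.

Lemma local_unit_regular f : local_unit f -> regular_value f.
Proof. by case=> v _; exists v. Qed.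

Lemma regular_valueM f g : regular_value f -> regular_value g -> regular_value (f * g).
Proof. by move=> [v fv] [w gw]; exists (v * w); apply: local_valueM. Qed.

Lemma regular_valueD f g : regular_value f -> regular_value g -> regular_value (f + g).
Proof. by move=> [v fv] [w gw]; exists (v + w); apply: local_valueD. Qed.

Lemma regular_value_tauX n : regular_value (tau ^+ n).
Proof.
elim: n => [|n IH].
  by exists 1; rewrite expr0 -(rmorph1 emb); apply: local_value_const.
by rewrite exprS; apply: regular_valueM => //; exists 0; apply: local_value_tau.
Qed.

(** For negative n the unit f would be a positive power of [tau] times a regular element, hence of
    value 0. *)
Lemma tau_expz_unit_ge0 (n : int) f g :
  local_unit f -> regular_value g -> g = tau ^ n * f -> 0 <= n.
Proof.
move=> uf [v gv] eg; case: n eg => // n eg.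
have [w w0 fw] := uf.
have [u gu] : regular_value (tau ^+ n * g).
  by apply: regular_valueM (regular_value_tauX n) _; exists v.
case/eqP: w0; apply: local_value_uniq fw _.
have -> : f = tau * (tau ^+ n * g).
  rewrite eg NegzE -exprnN mulrA -exprS mulVKf // expf_neq0 //; exact: tau_neq0.
by rewrite -(mul0r u); apply: local_valueM => //; apply: local_value_tau.
Qed.

Definition has_order f (n : int) := exists2 u, local_unit u & f = tau ^ n * u.

Lemma has_order_uniq f n k : has_order f n -> has_order f k -> n = k.
Proof.
have le n' k' : has_order f n' -> has_order f k' -> n' <= k'.
  move=> [u uu ->] [v uv e]; rewrite -subr_ge0.
  apply: (@tau_expz_unit_ge0 _ v u) => //; first exact: local_unit_regular.
  have t0 := tau_neq0; apply: (mulfI (expfz_neq0 n' t0)).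
  by rewrite e mulrA -expfzDr // addrCA subrr addr0.
by move=> fn fk; apply/eqP; rewrite eq_le !le.
Qed.

Lemma value_of_horner N : value_of (map_poly emb N).[t] N.[c].
Proof.
elim/poly_ind: N => [|N k IH].
  by rewrite rmorph0 !horner0 -{1}(rmorph0 emb); apply: value_of_const.
rewrite rmorphD rmorphM /= map_polyX map_polyC !hornerMXaddC.
by apply: value_ofD (value_of_const k); apply: value_ofM IH (gen_t _ _ _ _).
Qed.

(** Division of p by [tau] must stop. Write p p' = N(t) with N = N' (X - c)^n and N'(c) nonzero: if
    [tau]^(n+1) divided p, then N'(t) would be a multiple of [tau] in the local ring, so N'(c) would
    be 0. *)
Lemma generated_has_order p : gen p -> p != 0 -> exists n, has_order p n.
Proof.
move=> gp p0; have [p' [N [gp' N0 e]]] := generated_norm hs exyt gp p0.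
have t0 := tau_neq0.
have [n [N' rN eN]] := multiplicity_XsubC N c; rewrite N0 /= in rN.
(* As long as the quotient has value 0, [local_value0] allows one more division by [tau]. *)
have step k : (exists n, has_order p n) \/ exists2 g, regular_value g & p = tau ^+ k * g.
  elim: k => [|k [IH|[g [v gv] eg]]]; first 1 last.
  - by left.
  - have [v0|v0] := eqVneq v 0; last first.
      by left; exists k%:Z, g => //; exists v.
    rewrite v0 in gv; have [h [w [eh hw]]] := local_value0 gv.
    by right; exists h; [exists w|rewrite eg eh mulrA -exprSr].
  - right; exists p; last by rewrite mul1r.
    by have [u /value_of_local pu] := generated_value_of gp; exists u.
have [//|[g [v gv] eg]] := step n.+1.
have [w /value_of_local pw] := generated_value_of gp'.
have eN' : (map_poly emb N').[t] = tau * (g * p').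
  apply: (mulfI (expf_neq0 n t0)); rewrite !mulrA -exprSr -eg e eN.
  by rewrite rmorphM rmorphXn rmorphB /= map_polyX map_polyC /= hornerM horner_exp !hornerE mulrC.
have rg : regular_value (g * p') by apply: regular_valueM; [exists v|exists w].
have [u gu] := rg; case/negP: rN; apply/eqP.
apply: local_value_uniq (value_of_local (value_of_horner N')) _.
by rewrite eN' -(mul0r u); apply: local_valueM => //; apply: local_value_tau.
Qed.

Lemma exists_order f : f != 0 -> exists n, has_order f n.
Proof.
move=> f0; have [p [r [gp gr r0 ef]]] := field_generated_fraction gF f.
have p0 : p != 0 by apply: contraNneq f0 => p0; rewrite ef p0 mul0r.
have [n [u uu ep]] := generated_has_order gp p0.
have [k [v uv er]] := generated_has_order gr r0.
exists (n - k), (u / v); first exact/local_unitM/local_unitV.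
by rewrite ef ep er invfM expfzDr ?tau_neq0 // invr_expz mulrACA.
Qed.

Definition point_ord (f : F) : int :=
  if f == 0 then 0 else xget 0 [set n | has_order f n].

Lemma point_ordP f n : f != 0 -> has_order f n -> point_ord f = n.
Proof.
move=> /negPf f0 fn; rewrite /point_ord f0.
case: xgetP => [k _ fk|/(_ n)//]; exact: has_order_uniq fk fn.
Qed.

Lemma point_ord0 : point_ord 0 = 0.
Proof. by rewrite /point_ord eqxx. Qed.

Lemma point_ordM f g : f != 0 -> g != 0 -> point_ord (f * g) = point_ord f + point_ord g.
Proof.
move=> f0 g0; have [n fn] := exists_order f0; have [k gk] := exists_order g0.
rewrite (point_ordP f0 fn) (point_ordP g0 gk); apply: point_ordP; first exact: mulf_neq0.
have [u uu ->] := fn; have [v uv ->] := gk; exists (u * v); first exact: local_unitM.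
by rewrite expfzDr ?tau_neq0 // mulrACA.
Qed.

Lemma regular_value_tau_expz (n : int) : 0 <= n -> regular_value (tau ^ n).
Proof. by case: n => // n _; apply: regular_value_tauX. Qed.

Lemma point_ordD f g : f != 0 -> g != 0 -> f + g != 0 ->
  Num.min (point_ord f) (point_ord g) <= point_ord (f + g).
Proof.
move=> f0 g0 fg0; have [n fn] := exists_order f0; have [k gk] := exists_order g0.
have [l fgl] := exists_order fg0.
rewrite (point_ordP f0 fn) (point_ordP g0 gk) (point_ordP fg0 fgl).
(* With i the smaller of the two orders, (f + g) / [tau]^i is regular, so its order l - i is
   nonnegative. *)
have t0 := tau_neq0; set i := Num.min n k; rewrite -subr_ge0.
have [u uu ef] := fn; have [v uv eg] := gk; have [w uw efg] := fgl.
apply: (tau_expz_unit_ge0 uw (g := tau ^ (n - i) * u + tau ^ (k - i) * v)).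
  apply: regular_valueD; apply: regular_valueM; try exact: local_unit_regular;
    by apply: regular_value_tau_expz; rewrite subr_ge0 ge_min lexx ?orbT.
apply: (mulfI (expfz_neq0 i t0)).
rewrite mulrDr !mulrA -!expfzDr // ![i + _]addrC !subrK -ef -eg efg //.
Qed.

Lemma point_ordC k : k != 0 -> point_ord (emb k) = 0.
Proof.
move=> k0; apply: point_ordP; first by rewrite fmorph_eq0.
exists (emb k); last by rewrite expr0z mul1r.
by exists k => //; apply: local_value_const.
Qed.

Lemma point_ord_uniformizer : exists2 f, f != 0 & point_ord f = 1.
Proof.
exists tau; first exact: tau_neq0; apply: point_ordP; first exact: tau_neq0.
exists 1; last by rewrite mulr1 expr1z.
by exists 1; rewrite ?oner_neq0 // -(rmorph1 emb); apply: local_value_const.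
Qed.

Definition affine_place : curve_point emb :=
  CurvePoint point_ord0 point_ordM point_ordD point_ordC point_ord_uniformizer.

(** The valuation ring of this place is the local ring at (a, b, c), so that regularity at the place
    yields a denominator not vanishing at the point. *)
Lemma affine_place_regular f : 0 <= affine_place f <-> regular_value f.
Proof.
have [->|f0] := eqVneq f 0.
  by rewrite ord_zero; split=> // _; exists 0; rewrite -(rmorph0 emb); apply: local_value_const.
have [n fn] := exists_order f0; rewrite /= (point_ordP f0 fn).
have [u uu ef] := fn; split=> [n0|rf]; last exact: tau_expz_unit_ge0 uu rf ef.
rewrite ef; apply: regular_valueM (local_unit_regular uu).
exact: regular_value_tau_expz.
Qed.

End AffinePlace.

(** * Functions regular away from infinity *)

Section RegularFunctions.
Variable s : nat.
Hypothesis hs : (1 <= s)%N.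
Local Notation d := (q0 s).
Local Notation q := (q s).
Local Notation m := (q - 2 * d + 1)%N.
Local Notation M := (gen0 s).
Variables (K : closedFieldType) (F : fieldType) (emb : {rmorphism K -> F}) (x y t : F).
Hypothesis two0 : 2%:R = 0 :> F.
Hypothesis exyt : skabelund_eqs s x y t.
Hypothesis gF : field_generated emb x y t.
Variable P : curve_point emb.
Hypothesis Px : P x < 0.

Local Notation gen := (generated emb x y t).
Local Notation ideal := (generated_ideal emb x y t).

Lemma gen_one : gen 1.
Proof. by rewrite -(rmorph1 emb); apply: gen_const. Qed.

Definition ideal_add (I : F -> Prop) (v h : F) : Prop :=
  exists2 r, gen r & I (h - v * r).

Lemma ideal_addP I v : ideal I -> gen v -> ideal (ideal_add I v).
Proof.
move=> [ID IM] gv; split=> [f g [r gr If] [r' gr' Ig]|f g [r gr If] gg].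
  by exists (r + r'); [apply: gen_add|rewrite mulrDr opprD addrACA; apply: ID].
by exists (r * g); [apply: gen_mul|rewrite mulrA -mulrBl; apply: IM].
Qed.

Lemma ideal_addl I v h : I h -> ideal_add I v h.
Proof. by exists 0; [rewrite -(rmorph0 emb); apply: gen_const|rewrite mulr0 subr0]. Qed.

Lemma ideal0 I h : ideal I -> I h -> I 0.
Proof.
move=> [_ IM] Ih; rewrite -(mulr0 h) -(rmorph0 emb); apply: IM => //.
exact: gen_const.
Qed.

Lemma ideal_addr I v h : ideal I -> I h -> ideal_add I v v.
Proof. by move=> iI Ih; exists 1; [exact: gen_one|rewrite mulr1 subrr; apply: ideal0 iI Ih]. Qed.

(** If 1 = (u - a) g modulo I, then (u - a) p in I forces p in I; the factors are thus removed one
    at a time. This argument takes the place of choosing a maximal ideal. *)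
Lemma comaximal_prod I u (r : seq K) : ideal I -> gen u ->
  I (\prod_(a <- r) (u - emb a)) ->
  (forall a, a \in r -> ideal_add I (u - emb a) 1) -> I 1.
Proof.
move=> [ID IM] gu; elim: r => [|a r IH]; first by rewrite big_nil.
rewrite big_cons => Ip h; apply: IH => [|b br]; last by apply: h; rewrite inE br orbT.
have [g gg Ig] := h a (mem_head _ _); set p := \prod_(b <- r) _ in Ip *.
have gp : gen p.
  rewrite /p; elim/big_rec: _ => [|b f _ gf]; first exact: gen_one.
  by apply: gen_mul gf; apply: gen_add => //; apply/generated_opp/gen_const.
have -> : p = (1 - (u - emb a) * g) * p + (u - emb a) * p * g by ring.
by apply: ID; apply: IM.
Qed.

Lemma comaximal_horner I u (p : {poly K}) : ideal I -> gen u -> p != 0 ->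
  I (map_poly emb p).[u] ->
  (forall a, root p a -> ideal_add I (u - emb a) 1) -> I 1.
Proof.
move=> iI gu p0 Ip h; have [r er] := closed_field_poly_normal p.
have l0 : lead_coef p != 0 by rewrite lead_coef_eq0.
apply: (comaximal_prod (u := u) (r := r)) => // [|a ar]; last first.
  by apply: h; rewrite er rootZ // root_prod_XsubC.
have := proj2 iI _ _ Ip (gen_const emb x y t (lead_coef p)^-1).
rewrite {1}er map_polyZ hornerZ mulrC mulrA -rmorphM mulVf // rmorph1 mul1r.
rewrite rmorph_prod horner_prod; congr I; apply: eq_bigr => a _.
by rewrite rmorphB /= map_polyX map_polyC hornerXsubC.
Qed.

Lemma horner_expD (k : K) (u : F) :
  'X^q + ('X - k%:P) != 0 :> {poly K} /\
  (map_poly emb ('X^q + ('X - k%:P))).[u] = u ^+ q + u - emb k.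
Proof.
have q2 := q_ge2 hs; split.
  rewrite -size_poly_gt0 size_polyDl ?size_polyXn // size_XsubC; lia.
by rewrite rmorphD rmorphB /= map_polyXn map_polyX map_polyC !(hornerD, hornerN, hornerXn, hornerX, hornerC) addrA.
Qed.

Lemma root_expD (k a : K) : root ('X^q + ('X - k%:P)) a -> a ^+ q + a = k.
Proof.
by rewrite /root !(hornerD, hornerN, hornerXn, hornerX, hornerC) addrA subr_eq0 => /eqP.
Qed.

(** The ideal J of denominators of f contains a nonzero polynomial in t. Adjoining t - c, x - a and
    y - b in turn, for the finitely many values that the equations allow, reduces the claim to one
    point (a, b, c) of the curve at a time. There, regularity gives an element of J with nonzero
    value. *)
Lemma regular_generated f :
  (forall Q : curve_point emb, 0 <= Q x -> 0 <= Q f) -> gen f.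
Proof.
move=> rf; pose J h := gen h /\ gen (h * f).
have iJ : ideal J.
  split=> [h g [gh ghf] [gg ggf]|h g [gh ghf] gg]; split.
  - exact: gen_add.
  - by rewrite mulrDl; apply: gen_add.
  - exact: gen_mul.
  - by rewrite mulrAC; apply: gen_mul.
suff [_] : J 1 by rewrite mul1r.
have [p [r [gp gr r0 ef]]] := field_generated_fraction gF f.
have [r' [N [gr' N0 eN]]] := generated_norm hs exyt gr r0.
have gt := gen_t emb x y t; have gx := gen_x emb x y t; have gy := gen_y emb x y t.
have gC k : gen (- emb k) by apply/generated_opp/gen_const.
have JN : J (map_poly emb N).[t].
  rewrite -eN; split; first exact: gen_mul.
  have -> : r * r' * f = p * r' by rewrite ef; field.
  exact: gen_mul.
apply: (comaximal_horner iJ gt N0 JN) => c _.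
set J1 := ideal_add J (t - emb c).
have iJ1 : ideal J1 by apply: ideal_addP => //; apply: gen_add.
have J1t : J1 (t - emb c) := ideal_addr _ iJ JN.
have [px0 ex] := horner_expD (c ^+ m) x.
have [rt grt et] := generated_subX m gt (gen_const emb x y t c).
apply: (comaximal_horner iJ1 gx px0) => [|a /root_expD ea].
  by rewrite ex -(proj2 exyt) rmorphXn et; apply: (proj2 iJ1).
set J2 := ideal_add J1 (x - emb a).
have iJ2 : ideal J2 by apply: ideal_addP => //; apply: gen_add.
have J2x : J2 (x - emb a) := ideal_addr _ iJ1 J1t.
have J2t : J2 (t - emb c) := ideal_addl _ J1t.
have [py0 ey] := horner_expD (a ^+ d * (a ^+ q + a)) y.
have [rx grx ex'] := generated_subX d gx (gen_const emb x y t a).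
apply: (comaximal_horner iJ2 gy py0) => [|b /root_expD eb].
  rewrite ey (proj1 exyt) -(proj2 exyt) ea.
  have -> : x ^+ d * t ^+ m - emb (a ^+ d * c ^+ m) =
      (x - emb a) * (rx * t ^+ m) + (t - emb c) * (rt * emb a ^+ d).
    by rewrite !mulrA -ex' -et rmorphM !rmorphXn; ring.
  apply: (proj1 iJ2); apply: (proj2 iJ2) => //; apply: gen_mul => //.
    exact: generated_exp.
  exact/generated_exp/gen_const.
set J3 := ideal_add J2 (y - emb b).
have iJ3 : ideal J3 by apply: ideal_addP => //; apply: gen_add.
have J3y : J3 (y - emb b) := ideal_addr _ iJ2 J2x.
have J3x : J3 (x - emb a) := ideal_addl _ J2x.
have J3t : J3 (t - emb c) := ideal_addl _ J2t.
have eabc : skabelund_eqs s a b c by split; rewrite // ea.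
pose Q := affine_place hs two0 exyt gF Px eabc.
have regQ := affine_place_regular hs two0 exyt gF Px eabc.
have /regQ [_ [p1 [r1 [u [w [pu rw w0 ef1 _]]]]]] : 0 <= Q f.
  by apply/rf/regQ; exists a; apply: value_of_local; apply: gen_x.
have r10 := value_of_neq0 hs two0 exyt gF Px eabc rw w0.
have J3r : J3 r1.
  do 3![apply: ideal_addl]; split; first exact: value_of_generated rw.
  by rewrite ef1 mulrC divfK //; apply: value_of_generated pu.
(* The ideal [J3] contains [r1] and its difference with the nonzero constant [w], hence it contains
   1. *)
have := ideal_sub_value hs two0 exyt gF Px eabc iJ3 J3x J3y J3t rw.
move=> /(proj2 iJ3 _ (- emb w^-1)) /(_ (gC _)) h1.
have /(proj1 iJ3 _ _ h1) := proj2 iJ3 _ _ J3r (gen_const emb x y t w^-1).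
by rewrite mulrN -mulNr opprB -mulrDl subrK -rmorphM divff // rmorph1.
Qed.

Lemma generated_normal_form C : gen (normal_form (s := s) emb x y t C).
Proof.
have gx := gen_x emb x y t; have gy := gen_y emb x y t.
rewrite /normal_form; elim/big_rec: _ => [|[[[h i] j] k] f _ gf].
  by rewrite -(rmorph0 emb); apply: gen_const.
have gz : gen (zfun s x y) by apply: gen_add; [|]; apply: generated_exp.
have gw : gen (wfun s x y).
  by apply: gen_add; [apply: gen_mul => //|]; apply: generated_exp.
apply: gen_add gf; apply: gen_mul; first exact: generated_horner.
by rewrite /= /monomial; do !apply: gen_mul; apply: generated_exp => //; apply: gen_t.
Qed.

Lemma regular_xyt (Q : curve_point emb) : 0 <= Q x -> 0 <= Q y /\ 0 <= Q t.
Proof.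
move=> x0; have q2 := q_ge2 hs; have m0 : (0 < m)%N by rewrite addn1.
split.
  apply: (ord_expD_ge0 q2); rewrite (proj1 exyt).
  by apply: ord_ge0M; [apply: ord_ge0X|apply: ord_ge0D => //; apply: ord_ge0X].
have [->|t0] := eqVneq t 0; first by rewrite ord_zero.
have : 0 <= Q (t ^+ m) by rewrite (proj2 exyt); apply: ord_ge0D => //; apply: ord_ge0X.
by rewrite ordX // pmulr_rge0.
Qed.

Lemma generated_ordP n : (exists f, [/\ gen f, f != 0 & P f = - n%:Z]) <->
  exists (a : exponents s) (l : nat), n = (basis_degree a + M * l)%N.
Proof.
have [_ ordP] := place_at_infinity hs two0 exyt gF Px.
split=> [[f [gf f0 ef]]|[a [l ->]]].
  have [C [eC nC]] := generated_ord hs two0 exyt Px gf f0.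
  have [_ e] := ordP C nC.
  have [_ _ [_ _ _ [a _ d]]] := ord_normal_form hs two0 exyt Px nC.
  by exists a, (size (C a)).-1; rewrite -d; move: ef; rewrite eC e; lia.
pose C b := if b == a then 'X^l else 0 : {poly K}.
have nC : exists b, C b != 0 by exists a; rewrite /C eqxx monic_neq0 // monicXn.
exists (normal_form (s := s) emb x y t C); have [n0 ->] := ordP C nC.
split=> //; first exact: generated_normal_form.
rewrite /nf_degree (big_pred1 a) => [|b]; first by rewrite /C eqxx size_polyXn.
by rewrite /= /C; have [_|_] := eqVneq b a; rewrite ?eqxx // monic_neq0 // monicXn.
Qed.

Lemma Weierstrass_semigroupP n : Weierstrass_semigroup P n <->
  exists f, [/\ gen f, f != 0 & P f = - n%:Z].
Proof.
split=> [[f f0 poles]|[f [gf f0 ef]]].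
  have gf : gen f.
    apply: regular_generated => Q x0; have := poles Q.
    have -> : `[< Q = P >] = false by apply/asboolP => eQ; move: Px; rewrite -eQ; lia.
    by rewrite /pole_order; case: ltP => // ? ?; lia.
  exists f; split=> //.
  (* For n = 0 the pole order only says that f is regular at P; the normal form shows that the order
     is also at most 0. *)
  have [C [eC nC]] := generated_ord hs two0 exyt Px gf f0.
  have [_ /(_ C nC) [_ e]] := place_at_infinity hs two0 exyt gF Px.
  have := poles P; have -> : `[< P = P >] by apply/asboolP.
  by rewrite /pole_order eC e; case: ltP; lia.
exists f => // Q; case: asboolP => [->|nQ].
  by rewrite /pole_order ef; case: ltP; lia.
have x0 : 0 <= Q x.
  by rewrite leNgt; apply/negP => Qx; apply/nQ/(place_at_infinity_unique hs two0 exyt gF).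
have [y0 t0] := regular_xyt x0.
by have := ord_ge0_generated x0 y0 t0 gf; rewrite /pole_order leNgt => /negPf->.
Qed.

Lemma Weierstrass_semigroup_add n k : Weierstrass_semigroup P n ->
  Weierstrass_semigroup P k -> Weierstrass_semigroup P (n + k)%N.
Proof.
move=> /Weierstrass_semigroupP [f [gf f0 ef]] /Weierstrass_semigroupP [g [gg g0 eg]].
apply/Weierstrass_semigroupP; exists (f * g); split; first exact: gen_mul.
  exact: mulf_neq0.
by rewrite ordM // ef eg; lia.
Qed.

End RegularFunctions.

(** * The numerical semigroup *)

Section NumericalSemigroup.
Variable s : nat.
Hypothesis hs : (1 <= s)%N.
Local Notation d := (q0 s).
Local Notation q := (q s).
Local Notation m := (q - 2 * d + 1)%N.
Local Notation M := (gen0 s).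
Local Notation bdeg := (@basis_degree s).

Lemma gen0_le_gens : [/\ (M <= gen1 s)%N, (M <= gen2 s)%N, (M <= gen3 s)%N & (M <= gen4 s)%N].
Proof.
have := double_q0_lt_q hs; have := q0_ge2 hs; rewrite gen1E // gen2E // gen4E // /gen3 /gen0 => d2 dq.
by rewrite -mulnn; split; rewrite ?leq_mul2r ?leq_mul2l; apply/orP; right; lia.
Qed.

Lemma gen0_gt0 : (0 < M)%N.
Proof. have := double_q0_lt_q hs; rewrite /gen0 muln_gt0 addn1 ltn0Sn andbT => dq; exact: leq_ltn_trans dq. Qed.

(** Reflection of the box of exponents, which realizes the symmetry a -> max A - a of A. *)
Definition rev_exponents (a : exponents s) : exponents s :=
  let: (h, i, j, k) := a in (rev_ord h, rev_ord i, rev_ord j, rev_ord k).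

Definition max_degree : nat := degree s 1 (d - 1) (m - 1) (d - 1).

Lemma basis_degree_rev a : (bdeg a + bdeg (rev_exponents a))%N = max_degree.
Proof.
case: a => [[[h i] j] k]; rewrite /max_degree /= /degree.
move: (ltn_ord h) (ltn_ord i) (ltn_ord j) (ltn_ord k).
move: (nat_of_ord h) (nat_of_ord i) (nat_of_ord j) (nat_of_ord k).
move: (_ - _ + 1)%N => n; move: (q0 s) => D h' i' j' k' hh hi hj hk.
rewrite addnACA [X in (X + _)%N]addnACA [X in (X + _ + _)%N]addnACA -!mulnDl.
by congr (_ * _ + _ * _ + _ * _ + _ * _)%N; lia.
Qed.

Lemma gen0_le_max_degree : (M <= max_degree)%N.
Proof.
have [le1 _ _ _] := gen0_le_gens; rewrite /max_degree /degree mul1n.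
by move: (gen1 s) le1 => g le1; rewrite -!addnA; apply: (leq_trans le1); apply: leq_addr.
Qed.

(** The 2 d m d = qm degrees are distinct modulo qm by [basis_degree_inj], so they represent every
    residue class. *)
Lemma exists_residue (n : int) : exists a (k : int), n = (bdeg a)%:Z + M%:Z * k.
Proof.
have M0 := gen0_gt0.
pose f a : 'I_M := Ordinal (ltn_pmod (bdeg a) M0).
have inj_f : injective f.
  move=> a b [] e.
  apply: (@basis_degree_inj s hs a b (- (bdeg a %/ M)%N%:Z) (- (bdeg b %/ M)%N%:Z)).
  have := divn_eq (bdeg a) M; have := divn_eq (bdeg b) M; rewrite -e.
  by move: (bdeg a %/ M)%N (bdeg b %/ M)%N (bdeg a %% M)%N => u v w; lia.
have card : (#|'I_M| <= #|exponents s|)%N.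
  by rewrite card_ord !card_prod !card_ord /gen0 {1}qE; lia.
have nM0 : (0 <= (n %% M)%Z) && ((n %% M)%Z < M) by rewrite modz_ge0 ?ltz_pmod //; lia.
have lt : (`|(n %% M)%Z| < M)%N by lia.
have := inj_card_onto inj_f card (Ordinal lt) => /codomP [a /(congr1 val) /= e].
exists a, ((n %/ M)%Z - (bdeg a %/ M)%N%:Z).
have := divz_eq n M; have := divn_eq (bdeg a) M; rewrite -e.
move: (n %/ M)%Z (n %% M)%Z (bdeg a %/ M)%N (bdeg a) nM0 {e lt} => u r v w; lia.
Qed.

(** Membership is considered over all integers so that the reflection in [in_semigroup_sym] involves
    no truncated subtraction. *)
Definition in_semigroup (n : int) :=
  exists a (l : nat), n = (bdeg a)%:Z + M%:Z * l%:Z.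

(** If n = a + qm k with a in A, the reflected integer is (max A - a) + qm (-1 - k), and exactly one
    of k and -1 - k is nonnegative. *)
Lemma in_semigroup_sym (n : int) :
  in_semigroup n <-> ~ in_semigroup (max_degree%:Z - M%:Z - n).
Proof.
have M0 := gen0_gt0; split=> [[a [l ->]] [b [k e]]|].
  have := basis_degree_rev a => ea.
  have rab : rev_exponents a = b.
    by apply: (@basis_degree_inj s hs _ _ (- 1 - l%:Z) k%:Z); lia.
  by subst b; nia.
move=> nS; have [a [k e]] := exists_residue n; case: k e => [l|l] e; first by exists a, l.
case: nS; exists (rev_exponents a), l.
by have := basis_degree_rev a; rewrite NegzE in e; lia.
Qed.

Variable S : set nat.
Hypothesis SP : forall n, S n <-> exists a (l : nat), n = (bdeg a + M * l)%N.
Hypothesis SD : forall n k, S n -> S k -> S (n + k)%N.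

Lemma in_semigroup_nat n : S n <-> in_semigroup n%:Z.
Proof. by rewrite SP; split=> -[a [l e]]; exists a, l; lia. Qed.

Lemma in_semigroup_ge0 (n : int) : in_semigroup n -> 0 <= n.
Proof. by move=> [a [l ->]]; lia. Qed.

Lemma Aset_basis_degree n : Aset s n <-> exists a, n = bdeg a.
Proof.
have d0 := q0_ge2 hs; split=> [[h [i [j [k [hh hi hj hk ->]]]]]|[[[[h i] j] k] ->]].
  have hh' : (h < 2)%N by [].
  have hi' : (i < d)%N by lia.
  have hj' : (j < m)%N by lia.
  have hk' : (k < d)%N by lia.
  by exists (Ordinal hh', Ordinal hi', Ordinal hj', Ordinal hk').
exists h, i, j, k; move: (ltn_ord h) (ltn_ord i) (ltn_ord j) (ltn_ord k) => hh hi hj hk.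
by split=> //; lia.
Qed.

Lemma S_0 : S 0%N.
Proof.
have d0 := q0_ge2 hs; apply/SP.
have [a e] : exists a, 0%N = bdeg a.
  by apply/Aset_basis_degree; exists 0%N, 0%N, 0%N, 0%N; split; rewrite // !mul0n.
by exists a, 0%N; rewrite -e muln0.
Qed.

Lemma S_ge_gen0 n : S n -> (0 < n)%N -> (M <= n)%N.
Proof.
move=> /SP [a [l ->]]; case: l => [|l] n0; last by rewrite mulnS; lia.
have [l1 l2 l3 l4] := gen0_le_gens.
move: n0; rewrite muln0 addn0; case: a => [[[h i] j] k]; rewrite /= /degree.
move: (nat_of_ord h) (nat_of_ord i) (nat_of_ord j) (nat_of_ord k).
by case=> [|h'] [|i'] [|j'] [|k']; rewrite ?mul0n ?mulSn; lia.
Qed.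

Lemma S_gen0 : S M.
Proof.
have [a [k /esym/eqP]] := proj1 (SP 0) S_0; rewrite addn_eq0 => /andP[/eqP a0 _].
by apply/SP; exists a, 1%N; rewrite a0 add0n muln1.
Qed.

Lemma multiplicity_S : multiplicity S = M.
Proof.
rewrite /multiplicity; case: xgetP => [k _ [Sk k0 mk]|/(_ M) []].
  by apply/eqP; rewrite eqn_leq S_ge_gen0 // mk // ?gen0_gt0 //; apply: S_gen0.
by split; [apply: S_gen0|apply: gen0_gt0|apply: S_ge_gen0].
Qed.

Lemma Apery_S : Apery S = Aset s.
Proof.
apply/seteqP; split=> n; rewrite /Apery /= multiplicity_S.
  move=> [/SP [a [l ->]] nS]; apply/Aset_basis_degree; exists a.
  case: l nS => [|l] nS; first by rewrite muln0 addn0.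
  case: nS; rewrite mulnS; split; first lia.
  by apply/SP; exists a, l; lia.
move=> /Aset_basis_degree [a ->]; split; first by apply/SP; exists a, 0%N; rewrite muln0 addn0.
move=> [le /SP [b [l e]]].
(* An equality a - qm = b + qm l forces b = a by residues, and then l = -1. *)
have ab : a = b.
  by apply: (@basis_degree_inj s hs _ _ (- 1) l%:Z); lia.
by subst b; have := gen0_gt0; nia.
Qed.

(** The Frobenius number of the semigroup, as [conductor_S] confirms. *)
Let N := (max_degree - M)%N.

Lemma S_sym i : (i <= N)%N -> S i <-> ~ S (N - i)%N.
Proof.
move=> iN; rewrite !in_semigroup_nat in_semigroup_sym.
suff -> : max_degree%:Z - M%:Z - i%:Z = (N - i)%N%:Z by [].
by have := gen0_le_max_degree; move: iN; rewrite /N; lia.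
Qed.

Lemma gap_le n : ~ S n -> (n <= N)%N.
Proof.
move=> nS; rewrite leqNgt; apply/negP => Nn; apply/nS/in_semigroup_nat/in_semigroup_sym.
by move=> /in_semigroup_ge0; lia.
Qed.

Lemma gaps_finite : finite_set (~` S).
Proof.
apply: (sub_finite_set (B := `I_N.+1)); last exact: finite_II.
by move=> n /gap_le; rewrite /= ltnS.
Qed.

Lemma mem_gaps n : (n \in fset_set (~` S)) = (n <= N)%N && ~~ `[< S n >].
Proof.
rewrite in_fset_set; last exact: gaps_finite.
apply/idP/idP => [|/andP[_ /asboolPn nS]]; rewrite inE //=.
by move=> nS; rewrite gap_le //; apply/asboolPn.
Qed.

Lemma conductor_S : conductor S = N.+1.
Proof.
apply/eqP; rewrite eqn_leq; apply/andP; split.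
  by apply/bigmax_leqP_seq => n; rewrite mem_gaps => /andP[].
apply: (@leq_bigmax_seq _ _ xpredT (fun z => z.+1) N) => //.
rewrite mem_gaps leqnn; apply/asboolPn => SN.
by have := proj1 (S_sym (leq0n N)) S_0; rewrite subn0.
Qed.

(** The reflection i -> N - i exchanges gaps and elements in [0, N], so twice the number of gaps
    counts this interval. *)
Lemma genus_S : (2 * genus S)%N = N.+1.
Proof.
pose gap i : nat := ~~ `[< S i >].
have -> : genus S = (\sum_(i < N.+1) gap i)%N.
  rewrite /genus; have /perm_size -> : perm_eq (fset_set (~` S)) [seq n <- iota 0 N.+1 | ~~ `[< S n >]].
    apply: uniq_perm; rewrite ?fset_uniq ?filter_uniq ?iota_uniq // => n.
    by rewrite mem_gaps mem_filter mem_iota andbC.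
  rewrite size_filter -sum1_count big_mkcond -(big_mkord xpredT gap) /index_iota subn0.
  by apply: eq_bigr => i _; rewrite /gap; case: ifP.
rewrite mul2n -addnn {2}(reindex_inj rev_ord_inj) -big_split /=.
rewrite (eq_bigr (fun=> 1%N)) => [|i _]; first by rewrite sum1_card card_ord.
have iN : (i <= N)%N by rewrite -ltnS.
rewrite /gap subSS; have := S_sym iN.
by case: asboolP => h; case: asboolP => h' // [h1 h2]; [case: (h1 h)|case: (h (h2 h'))].
Qed.

Lemma symmetric_S : symmetric_semigroup S.
Proof.
split; last by rewrite conductor_S genus_S.
by split; [exact: S_0|exact: SD|exact: gaps_finite].
Qed.

End NumericalSemigroup.

(** * Change of coordinates *)

Section CoordinateChange.
Variable s : nat.
Hypothesis hs : (1 <= s)%N.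
Local Notation d := (q0 s).
Local Notation q := (q s).
Local Notation m := (q - 2 * d + 1)%N.
Variables (K F : fieldType) (emb : {rmorphism K -> F}).
Hypothesis two0 : 2%:R = 0 :> F.

Lemma field_generated_translate (x y t : F) (a b : K) :
  field_generated emb x y t ->
  field_generated emb (x + emb a) (y + emb b + emb a ^+ d * (x + emb a)) t.
Proof.
move=> gF S SC Sx Sy St SD SM SV.
have SN f : S f -> S (- f) by move=> Sf; rewrite -mulN1r -(rmorph1 emb) -rmorphN; apply: SM.
have Sx' : S x by rewrite -(addrK (emb a) x); apply: SD => //; apply: SN.
apply: gF => //.
have -> : y = y + emb b + emb a ^+ d * (x + emb a) - emb a ^+ d * (x + emb a) - emb b by ring.
apply: (SD _ _ _ (SN _ (SC b))); apply: SD => //; apply: SN.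
by rewrite -rmorphXn; apply: SM.
Qed.

(** A subfield containing the new coordinates contains the z and w formed from them, which are x/w
    and 1/w; hence it contains w, and with it x, y and t. *)
Lemma field_generated_invert (x y t : F) :
  skabelund_eqs s x y t -> wfun s x y != 0 -> field_generated emb x y t ->
  field_generated emb (zfun s x y / wfun s x y) (y / wfun s x y) (t / wfun s x y).
Proof.
move=> exyt w0 gF S SC Sx Sy St SD SM SV.
have SX f n : S f -> S (f ^+ n).
  move=> Sf; elim: n => [|n IH]; last by rewrite exprS; apply: SM.
  by rewrite expr0 -(rmorph1 emb); apply: SC.
have Sz : S (zfun s (zfun s x y / wfun s x y) (y / wfun s x y)).
  by apply: SD; apply: SX.
have Sw : S (wfun s (zfun s x y / wfun s x y) (y / wfun s x y)).
  by apply: SD; [apply: SM => //|]; apply: SX.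
rewrite (zfun_invert hs two0 exyt w0) in Sz.
rewrite (wfun_invert hs two0 exyt w0) in Sw.
have {}Sw : S (wfun s x y) by rewrite -[wfun s x y]invrK; apply: SV.
have mulw f : S (f / wfun s x y) -> S f by move=> Sf; rewrite -(divfK w0 f); apply: SM.
by apply: gF => //; apply: mulw.
Qed.

Variables (P : curve_point emb).

Lemma vanishes_atD f g : vanishes_at P f -> vanishes_at P g -> vanishes_at P (f + g).
Proof.
move=> [->|f0]; first by rewrite add0r.
move=> [->|g0]; first by rewrite addr0; right.
have [->|nf] := eqVneq f 0; first by rewrite add0r; right.
have [->|ng] := eqVneq g 0; first by rewrite addr0; right.
have [->|nfg] := eqVneq (f + g) 0; first by left.
by right; apply: lt_le_trans (ordD P nf ng nfg); rewrite lt_min f0.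
Qed.

Lemma vanishes_atM f g : vanishes_at P f -> regular_at P g -> vanishes_at P (f * g).
Proof.
move=> [->|f0] g0; first by rewrite mul0r; left.
have [->|nf] := eqVneq f 0; first by rewrite mul0r; left.
have [->|ng] := eqVneq g 0; first by rewrite mulr0; left.
by right; rewrite ordM // ltr_wpDr.
Qed.

Lemma vanishes_at_regular f : vanishes_at P f -> regular_at P f.
Proof. by move=> [->|/ltW//]; rewrite /regular_at ord_zero. Qed.

Lemma vanishes_atX f n : vanishes_at P f -> (0 < n)%N -> vanishes_at P (f ^+ n).
Proof.
move=> vf; case: n => // n _; rewrite exprS; apply: vanishes_atM => //.
exact/ord_ge0X/vanishes_at_regular.
Qed.

Variables (x y t : F).
Hypothesis exyt : skabelund_eqs s x y t.
Hypothesis gF : field_generated emb x y t.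

(** If x were 0, the equations would give t = 0 and, as y vanishes at P, also y = 0. Then F would be
    K, where no element has order 1. *)
Lemma x_neq0_of_vanishing : vanishes_at P y -> x != 0.
Proof.
move=> vy; apply/eqP => x0; have q2 := q_ge2 hs; have d2 := q0_ge2 hs; have [ey et] := exyt.
have t0 : t = 0.
  apply/eqP; move: et; rewrite x0 expr0n addr0 (_ : q == 0%N = false); last by lia.
  by move=> /eqP; rewrite expf_eq0 => /andP[].
have y0 : y = 0.
  apply: contrapT => /eqP y0; case: vy => [/eqP|ly]; first by rewrite (negPf y0).
  have [/eqP[]] := ord_expD_zero q2 y0 ly.
  by rewrite ey x0 expr0n (_ : d == 0%N = false) ?mul0r //; lia.
have [f f0 f1] := ord_uniformizer P.
have [c ec] : exists c, f = emb c.
  refine (@gF (fun g => exists c, g = emb c) _ _ _ _ _ _ _ f) => [c||||g h [c ->] [c' ->]|g h [c ->] [c' ->]|g [c ->]].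
  - by exists c.
  - by exists 0; rewrite rmorph0.
  - by exists 0; rewrite rmorph0.
  - by exists 0; rewrite rmorph0.
  - by exists (c + c'); rewrite rmorphD.
  - by exists (c * c'); rewrite rmorphM.
  - by exists c^-1; rewrite fmorphV.
by move: f1; rewrite ec ordC //; apply: contraNneq f0 => c0; rewrite ec c0 rmorph0.
Qed.

(* Comparing orders in the Artin-Schreier equations of y, z and w gives
   ord z = (2d + 1) ord x < (q + 2d + 1) ord x = ord w. *)
Lemma invert_pole : vanishes_at P x -> vanishes_at P y ->
  wfun s x y != 0 /\ P (zfun s x y / wfun s x y) < 0.
Proof.
move=> vx vy; have q2 := q_ge2 hs; have d2 := q0_ge2 hs.
have x0 := x_neq0_of_vanishing vy.
have lx : 0 < P x by case: vx => // /eqP; rewrite (negPf x0).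
have [D0 eD] := ord_expD_zero q2 x0 lx.
have AS f h : f ^+ q + f = h -> h != 0 -> vanishes_at P f -> f != 0 /\ P f = P h.
  move=> ef h0 vf; have f0 : f != 0.
    apply: contraNneq h0 => f0; rewrite -ef f0 expr0n addr0.
    by rewrite (_ : q == 0%N = false) //; lia.
  have lf : 0 < P f by case: vf => // /eqP; rewrite (negPf f0).
  by split=> //; rewrite -ef; case: (ord_expD_zero q2 f0 lf).
have nx n : x ^+ n != 0 by rewrite expf_neq0.
have [y0 ey] := AS _ _ (proj1 exyt) (mulf_neq0 (nx d) D0) vy.
have vz : vanishes_at P (zfun s x y).
  by apply: vanishes_atD; apply: vanishes_atX => //; lia.
have [z0 ez] := AS _ _ (z_eq hs two0 exyt) (mulf_neq0 (expf_neq0 2 (nx d)) D0) vz.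
have vw : vanishes_at P (wfun s x y).
  apply: vanishes_atD; last by apply: vanishes_atX => //; lia.
  by apply: vanishes_atM => //; apply/ord_ge0X/vanishes_at_regular.
have [w0 ew] := AS _ _ (w_eq hs two0 exyt) (mulf_neq0 (expf_neq0 (2 * d) y0) D0) vw.
split=> //; rewrite ordM ?invr_eq0 // ordV // ez ew !ordM ?expf_neq0 //.
rewrite !ordX ?expf_neq0 // ey ordM ?expf_neq0 // ordX // eD; nia.
Qed.

End CoordinateChange.

Lemma semigroup_at_pole (s : nat) (hs : (1 <= s)%N) (K : closedFieldType) (F : fieldType)
    (emb : {rmorphism K -> F}) (x y t : F) (P : curve_point emb) :
  2%:R = 0 :> F -> skabelund_eqs s x y t -> field_generated emb x y t -> P x < 0 ->
  Apery (Weierstrass_semigroup P) = Aset s /\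
  symmetric_semigroup (Weierstrass_semigroup P).
Proof.
move=> two0 exyt gF Px.
have SP n : Weierstrass_semigroup P n <->
    exists (a : exponents s) (l : nat), n = (basis_degree a + gen0 s * l)%N.
  by rewrite (Weierstrass_semigroupP hs two0 exyt gF Px) (generated_ordP hs two0 exyt gF Px).
split; first exact: Apery_S hs _ SP.
apply: (symmetric_S hs SP) => n k; exact: (Weierstrass_semigroup_add hs two0 exyt gF Px).
Qed.

Lemma rational_semigroup (s : nat) (hs : (1 <= s)%N) (K : closedFieldType) (F : fieldType)
    (emb : {rmorphism K -> F}) (x y t : F) (P : curve_point emb) (a b : K) :
  2%:R = 0 :> F -> skabelund_eqs s x y t -> field_generated emb x y t ->
  a ^+ q s = a -> b ^+ q s = b ->
  vanishes_at P (x - emb a) -> vanishes_at P (y - emb b) ->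
  Apery (Weierstrass_semigroup P) = Aset s /\
  symmetric_semigroup (Weierstrass_semigroup P).
Proof.
move=> two0 exyt gF aq bq vx vy.
have eaq : emb a ^+ q s = emb a by rewrite -rmorphXn aq.
have ebq : emb b ^+ q s = emb b by rewrite -rmorphXn bq.
have exyt1 := skabelund_translate two0 eaq ebq exyt.
have gF1 := @field_generated_translate s _ _ emb _ _ _ a b gF.
rewrite !(oppr_mod2 two0) in vx vy.
(* The correction term of the translation vanishes at P together with x + a. *)
have vy1 : vanishes_at P (y + emb b + emb a ^+ q0 s * (x + emb a)).
  apply: vanishes_atD => //; rewrite mulrC; apply: vanishes_atM => //.
  by apply/ord_ge0X/ord_const_ge0.
have [w0 Pw] := invert_pole hs two0 exyt1 gF1 vx vy1.
apply: (semigroup_at_pole hs two0 (skabelund_invert hs two0 exyt1 w0) _ Pw).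
exact: field_generated_invert.
Qed.

(** Translation by 1 permutes the field, so comparing the sums of all elements gives 2^n = 0 in it,
    whence 2 = 0. *)
Lemma card_finField_char2 (Fq : finFieldType) (n : nat) : #|Fq| = (2 ^ n)%N -> 2%:R = 0 :> Fq.
Proof.
move=> card.
have e : \sum_(u : Fq) (u + 1) = \sum_(u : Fq) u by rewrite [RHS](reindex_inj (addIr 1)).
move: e; rewrite big_split /= sumr_const card => /eqP.
by rewrite -subr_eq0 addrAC subrr add0r natrX expf_eq0 => /andP[_ /eqP].
Qed.

(** * From the function field of the affine curve to equations and generators *)

Section FunctionField.
Variables (K F : fieldType) (emb : {rmorphism K -> F}) (x y t : F).

Lemma mmap_triple (k : fieldType) (e : {rmorphism k -> F}) (i : 'I_3) :
  mmap e (triple x y t) 'X_i = triple x y t i.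
Proof. by rewrite mmapX mmap1U. Qed.

Lemma function_field_generated (C : K -> K -> K -> Prop) :
  is_function_field C emb x y t -> field_generated emb x y t.
Proof.
move=> [_ fr] S SC Sx Sy St SD SM SV f.
have Smmap p : S (mmap emb (triple x y t) p).
  rewrite /mmap; elim/big_rec: _ => [|m g _ Sg]; first by rewrite -(rmorph0 emb); apply: (SC).
  apply: (SD) => //; apply: (SM) => //; rewrite /mmap1.
  elim/big_rec: _ => [|i h _ Sh]; first by rewrite -(rmorph1 emb); apply: (SC).
  apply: (SM) => //; elim: (m i) => [|n IH]; first by rewrite expr0 -(rmorph1 emb); apply: (SC).
  rewrite exprS; apply: (SM) => //.
  by case: i {h Sh IH} => [[|[|[|//]]] i3]; rewrite /triple (tnth_nth 0).
have [p [r [_ ->]]] := fr f.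
by apply: (SM) => //; apply: (SV).
Qed.

(** The two defining polynomials vanish on the curve, so they lie in the kernel of evaluation at (x,
    y, t). *)
Lemma function_field_eqs s : is_function_field (@affine_curve s K) emb x y t ->
  skabelund_eqs s x y t.
Proof.
move=> [ker _].
have tr (T : Type) (u v w : T) : [/\ triple u v w (inord 0) = u, triple u v w (inord 1) = v
    & triple u v w (inord 2) = w].
  by split; rewrite /triple (tnth_nth u) /= inordK.
have [h0 h1 h2] := tr _ x y t.
split; apply/eqP; rewrite -subr_eq0; apply/eqP.
  have /proj2 := ker ('X_(inord 1) ^+ q s + 'X_(inord 1) -
    'X_(inord 0) ^+ q0 s * ('X_(inord 0) ^+ q s + 'X_(inord 0))).
  rewrite !(rmorphB, rmorphD, rmorphM, rmorphXn) /= !mmap_triple h0 h1; apply.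
  move=> a b c [e _]; have [k0 k1 _] := tr _ a b c.
  by rewrite !(rmorphB, rmorphD, rmorphM, rmorphXn) /= !mevalXU k0 k1 e subrr.
have /proj2 := ker ('X_(inord 2) ^+ (q s - 2 * q0 s + 1) -
    ('X_(inord 0) ^+ q s + 'X_(inord 0))).
rewrite !(rmorphB, rmorphD, rmorphM, rmorphXn) /= !mmap_triple h0 h2; apply.
move=> a b c [_ e]; have [k0 _ k2] := tr _ a b c.
by rewrite !(rmorphB, rmorphD, rmorphM, rmorphXn) /= !mevalXU k0 k2 e subrr.
Qed.

End FunctionField.

Theorem corollary3p3 (s : nat) (hs : (1 <= s)%N)
    (Fq : finFieldType) (hFq : #|Fq| = q s)
    (Fqbar : closedFieldType) (iota : {rmorphism Fq -> Fqbar})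
    (hbar : forall a : Fqbar, algebraicOver iota a)
    (F : fieldType) (emb : {rmorphism Fqbar -> F}) (x y t : F)
    (hF : is_function_field (@affine_curve s Fqbar) emb x y t)
    (P : curve_point emb) (hP : rational_point iota x y t P) :
  Apery (Weierstrass_semigroup P) = Aset s /\
  symmetric_semigroup (Weierstrass_semigroup P).
Proof.
have two0 : 2%:R = 0 :> F.
  rewrite -(rmorph_nat emb) -(rmorph_nat iota) (@card_finField_char2 Fq (2 * s + 1)).
    by rewrite !rmorph0.
  by rewrite hFq q_expn.
have exyt := function_field_eqs hF; have gF := function_field_generated hF.
(* A pole of x is the point at infinity; any other place is centered at an affine point. *)
have [Px|Px] := ltP (P x) 0; first exact: (semigroup_at_pole hs two0 exyt gF Px).
have [Py _] := regular_xyt hs exyt Px.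
(* Rationality is applied to the fraction X_i / 1: the value of the coordinate comes from [Fq],
   whose elements are fixed by the q-th power. *)
have rat (i : 'I_3) : 0 <= P (triple x y t i) ->
    exists c : Fqbar, c ^+ q s = c /\ vanishes_at P (triple x y t i - emb c).
  move=> Pi; have := hP 'X_i 1.
  have -> : mmap (emb \o iota) (triple x y t) 'X_i = triple x y t i.
    exact: (mmap_triple _ _ _ (emb \o iota : {rmorphism _ -> _})).
  rewrite [mmap _ _ 1]rmorph1 divr1 => /(_ (oner_neq0 _) Pi) [c vc]; exists (iota c); split=> //.
  by rewrite -rmorphXn -hFq expf_card.
have [a [aq va]] := rat (@Ordinal 3 0 isT) Px.
have [b [bq vb]] := rat (@Ordinal 3 1 isT) Py.
exact: (rational_semigroup hs two0 exyt gF aq bq va vb).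
Qed.
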